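(* Let $0<r_1<r_2<1$ be fixed and let $T:\mathrm{Hol}(\mathbb{D})\to\mathrm{Hol}(\mathbb{D})$ be a linear continuous operator such that for all $f\in\mathrm{Hol}(\mathbb{D})$ and $i\in\{1,2\}$, \[ \|Tf\|_{\infty,r_i}=\|f\|_{\infty,r_i},\qquad\text{where } \|f\|_{\infty,r}=\sup_{|z|\le r}|f(z)|. \] Then there exist $\alpha,\beta\in\mathbb{C}$ with $|\alpha|=|\beta|=1$ such that $(Tf)(z)=\alpha f(\beta z)$ for all $f\in\mathrm{Hol}(\mathbb{D})$ and $z\in\mathbb{D}$.
   Context: $\mathbb{D}$ is the open unit disc and $\mathrm{Hol}(\mathbb{D})$ the space of holomorphic functions on $\mathbb{D}$ with the topology of uniform convergence on compact subsets. *)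

(* Defs.v *)
From HB Require Import structures.
From mathcomp Require Import all_boot all_order all_algebra.
From mathcomp Require Import complex.
From mathcomp Require Import all_classical all_reals all_analysis.
Set Implicit Arguments. Unset Strict Implicit. Unset Printing Implicit Defensive.
Import Order.TTheory GRing.Theory Num.Theory.
Import numFieldNormedType.Exports.
Local Open Scope ring_scope.
Local Open Scope classical_set_scope.
Local Open Scope complex_scope.

Notation normc := (@ComplexField.Normc.normc _).

Section Defs.
Variable R : realType.
Local Notation C := (R[i])^o.

Definition udisc : set C := [set z | normc z < 1].

Definition holo (f : C -> C) : Prop := forall z, udisc z -> derivable f z 1.

Definition supnorm (r : R) (f : C -> C) : R :=
  sup [set normc (f z) | z in [set z : C | normc z <= r]].
End Defs.
Arguments udisc {R}.

(* Main.v *)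
Require Import Defs.
From HB Require Import structures.
From mathcomp Require Import all_boot all_order all_algebra.
From mathcomp Require Import complex.
From mathcomp Require Import all_classical all_reals all_analysis.
From mathcomp Require Import ring lra zify.
Import Order.TTheory GRing.Theory Num.Theory.
Import numFieldNormedType.Exports.
Local Open Scope ring_scope.
Local Open Scope classical_set_scope.
Local Open Scope complex_scope.
Set Implicit Arguments.
Unset Strict Implicit.
Unset Printing Implicit Defensive.

(** [T 1] has the same supremum 1 on both discs, hence it is a constant [alpha] by the
    maximum modulus principle. Put [phi = T(id) / alpha]. For [|p| = r1] the function
    [z + p] has norm [2 r1], so [phi] takes the value [p] on the closed disc of
    radius [r1]. In particular the antipodal points [r1] and [- r1] have preimages
    [q] and [q'] there; since [phi] maps the disc of radius [r2] into itself, the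
    Schwarz-Pick inequality between [q] and [q'] forces [q' = - q] and is an equality,
    so [phi] is a rotation [z |-> beta z]. On [|z| = r1] the functional [f |-> T f z]
    is bounded by the norm and attains it on a function peaking only at [beta z];
    perturbing this function by small multiples of [f - f (beta z)] gives
    [T f z = alpha f (beta z)], which extends to the unit disc by the maximum modulus
    principle and unique continuation.

    The maximum modulus principle for functions that are only assumed complex
    differentiable is obtained from Goursat's bisection argument, applied to the
    Riemann sums of [f (r exp w)] over a rectangle of height [2 pi]. *)

(** * Modulus and complex differentiability *)

Section Normc.
Variable R : realType.
Implicit Types (x y z w : R[i]) (r : R).

Definition nsq z : R := complex.Re z ^+ 2 + complex.Im z ^+ 2.

Lemma nsq_ge0 z : 0 <= nsq z.
Proof. by rewrite /nsq addr_ge0 ?sqr_ge0. Qed.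

Lemma normc_ge0 z : 0 <= normc z.
Proof. by case: z => a b; rewrite /= sqrtr_ge0. Qed.

Lemma normc_sq z : normc z ^+ 2 = nsq z.
Proof. by case: z => a b; rewrite /= sqr_sqrtr // addr_ge0 ?sqr_ge0. Qed.

Lemma normcD z w : normc (z + w) <= normc z + normc w.
Proof. exact: le_normcD. Qed.

Lemma normc_opp z : normc (- z) = normc z.
Proof. exact: normcN. Qed.

Lemma normcB z w : normc (z - w) <= normc z + normc w.
Proof. by rewrite (le_trans (normcD _ _)) // normc_opp. Qed.

Lemma distcC z w : normc (z - w) = normc (w - z).
Proof. by rewrite -opprB normc_opp. Qed.

Lemma normcBl z w : normc z - normc w <= normc (z - w).
Proof. by rewrite lerBlDr (le_trans _ (normcD _ _)) // subrK. Qed.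

Lemma normc_eq0 z : (normc z == 0) = (z == 0).
Proof.
apply/eqP/eqP => [/ComplexField.Normc.eq0_normc //|->].
exact: ComplexField.Normc.normc0.
Qed.

Lemma normc_gt0 z : (0 < normc z) = (z != 0).
Proof. by rewrite lt_def normc_ge0 andbT normc_eq0. Qed.

Lemma normcX z n : normc (z ^+ n) = normc z ^+ n.
Proof.
elim: n => [|n IH]; first by rewrite !expr0 ComplexField.Normc.normc1.
by rewrite !exprS ComplexField.Normc.normcM IH.
Qed.

Lemma normc_real r : normc r%:C = `|r|.
Proof. by rewrite /= expr0n addr0 sqrtr_sqr. Qed.

Lemma normc_conj z : normc (conjc z) = normc z.
Proof. by case: z => a b; rewrite /= sqrrN. Qed.

Lemma normc_div z w : normc (z / w) = normc z / normc w.
Proof. by rewrite ComplexField.Normc.normcM ComplexField.Normc.normcV. Qed.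

Lemma normc_le z r : 0 <= r -> nsq z <= r ^+ 2 -> normc z <= r.
Proof. by move=> r0 h; rewrite -ler_sqr ?nnegrE ?normc_ge0 // normc_sq. Qed.

Lemma nsq_le z r : normc z <= r -> nsq z <= r ^+ 2.
Proof.
move=> h; rewrite -normc_sq ler_sqr ?nnegrE ?normc_ge0 //.
exact: le_trans (normc_ge0 z) h.
Qed.

Lemma nsq_lt z r : normc z < r -> nsq z < r ^+ 2.
Proof.
move=> h; rewrite -normc_sq ltr_sqr ?nnegrE ?normc_ge0 //.
exact: le_trans (normc_ge0 z) (ltW h).
Qed.

Lemma mul_conjc z : conjc z * z = (nsq z)%:C.
Proof.
by case: z => a b; rewrite /nsq /=; simpc; congr (_ +i* _); ring.
Qed.

Lemma Re_le_normc z : `|complex.Re z| <= normc z.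
Proof.
by rewrite -ler_sqr ?nnegrE ?normc_ge0 // normc_sq /nsq real_normK ?num_real //
  lerDl sqr_ge0.
Qed.

Lemma Im_le_normc z : `|complex.Im z| <= normc z.
Proof.
by rewrite -ler_sqr ?nnegrE ?normc_ge0 // normc_sq /nsq real_normK ?num_real //
  lerDr sqr_ge0.
Qed.

Lemma normc_le_ReIm z : normc z <= `|complex.Re z| + `|complex.Im z|.
Proof.
apply: normc_le; first by rewrite addr_ge0.
have -> : nsq z = `|complex.Re z| ^+ 2 + `|complex.Im z| ^+ 2.
  by rewrite /nsq !real_normK ?num_real.
by rewrite sqrrD lerD2r lerDl mulrn_wge0 // mulr_ge0.
Qed.

End Normc.

(** * Epsilon-delta continuity and the calculus of complex differentiable functions *)

Section Differentiability.
Variable R : realType.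
Implicit Types (f g h : R[i] -> R[i]) (z w c : R[i]).

Definition ccont f z := forall e : R, 0 < e ->
  exists2 d : R, 0 < d & forall w, normc (w - z) < d -> normc (f w - f z) < e.

(* Caratheodory's form of complex differentiability. *)
Definition cdiff f z := exists2 s : R[i] -> R[i],
  ccont s z & forall w, f w - f z = s w * (w - z).

Lemma eq_ccont f g z : f =1 g -> ccont f z -> ccont g z.
Proof. by move=> /funext ->. Qed.

Lemma eq_cdiff f g z : f =1 g -> cdiff f z -> cdiff g z.
Proof. by move=> /funext ->. Qed.

Lemma ccont_cst c z : ccont (fun=> c) z.
Proof.
by move=> e e0; exists 1 => // w _; rewrite subrr ComplexField.Normc.normc0.
Qed.

Lemma ccont_id z : ccont id z.
Proof. by move=> e e0; exists e. Qed.

Lemma ccontD f g z : ccont f z -> ccont g z -> ccont (fun w => f w + g w) z.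
Proof.
move=> fz gz e e0; have e2 : 0 < e / 2 by rewrite divr_gt0.
have [d d0 fd] := fz _ e2; have [d' d'0 gd] := gz _ e2.
exists (Num.min d d'); first by rewrite lt_min d0.
move=> w; rewrite lt_min => /andP[wd wd'].
have -> : f w + g w - (f z + g z) = (f w - f z) + (g w - g z) by ring.
by rewrite (le_lt_trans (normcD _ _)) // (splitr e) ltrD ?fd ?gd.
Qed.

Lemma ccont_bounded f z : ccont f z ->
  exists2 d : R, 0 < d & forall w, normc (w - z) < d ->
    normc (f w) <= normc (f z) + 1.
Proof.
move=> /(_ 1 ltr01)[d d0 fd]; exists d => // w /fd wd.
have := normcBl (f w) (f z); lra.
Qed.

Lemma ccontM f g z : ccont f z -> ccont g z -> ccont (fun w => f w * g w) z.
Proof.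
move=> fz gz e e0.
have [d d0 fd] := ccont_bounded fz.
(* [K] dominates [normc (f w)] near [z], and [K - 1] dominates [normc (g z)]; the error terms carry
   the weights [K] and [K - 1], which keeps the final inequality strict. *)
set K := normc (f z) + 1 + normc (g z).
have K0 : 0 < K by have := normc_ge0 (f z); have := normc_ge0 (g z); rewrite /K; lra.
have e2 : 0 < e / (2 * K) by rewrite divr_gt0 ?mulr_gt0.
have [d1 d10 fd1] := fz _ e2; have [d2 d20 gd] := gz _ e2.
exists (Num.min d (Num.min d1 d2)); first by rewrite !lt_min d0 d10.
move=> w; rewrite !lt_min => /and3P[/fd wd /fd1 wd1 /gd wd2].
have -> : f w * g w - f z * g z = f w * (g w - g z) + g z * (f w - f z) by ring.
rewrite (le_lt_trans (normcD _ _)) // !ComplexField.Normc.normcM.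
have h1 : normc (f w) * normc (g w - g z) <= K * (e / (2 * K)).
  apply: ler_pM; rewrite ?normc_ge0 ?(ltW wd2) //.
  by rewrite (le_trans wd) // /K lerDl normc_ge0.
have h2 : normc (g z) * normc (f w - f z) <= (K - 1) * (e / (2 * K)).
  apply: ler_pM; rewrite ?normc_ge0 ?(ltW wd1) //.
  by rewrite /K; have := normc_ge0 (f z); lra.
apply: (le_lt_trans (lerD h1 h2)).
have eE : (K + K) * (e / (2 * K)) = e by field; rewrite gt_eqF.
by rewrite -[ltRHS]eE -mulrDl ltr_pM2r // ltrD2l gtrBl.
Qed.

Lemma ccontV f z : f z != 0 -> ccont f z -> ccont (fun w => (f w)^-1) z.
Proof.
rewrite -normc_gt0 => fz0 fz e e0.
have a0 : 0 < normc (f z) / 2 by lra.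
have b0 : 0 < e * (normc (f z) * (normc (f z) / 2)) by rewrite !mulr_gt0.
(* The radius [d1] keeps [normc (f w)] above half of [normc (f z)]; [d2] absorbs the resulting lower
   bound of the denominator. *)
have [d1 d10 h1] := fz _ a0; have [d2 d20 h2] := fz _ b0.
exists (Num.min d1 d2); first by rewrite !lt_min d10.
move=> w; rewrite !lt_min => /andP[/h1 w1 /h2 w2].
have fw0 : normc (f z) / 2 < normc (f w).
  by have := normcBl (f z) (f w); rewrite distcC; lra.
have fwn : f w != 0 by rewrite -normc_gt0; lra.
have fzn : f z != 0 by rewrite -normc_gt0; lra.
have -> : (f w)^-1 - (f z)^-1 = (f z - f w) / (f z * f w).
  by field; rewrite fzn fwn.
rewrite normc_div ltr_pdivrMr; last by rewrite normc_gt0 mulf_neq0.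
rewrite distcC (lt_le_trans w2) // ComplexField.Normc.normcM.
by rewrite !ler_wpM2l ?ltW.
Qed.

Lemma ccont_comp f g z : ccont f z -> ccont g (f z) -> ccont (g \o f) z.
Proof.
move=> fz gz e e0; have [d d0 gd] := gz _ e0; have [d' d'0 fd] := fz _ d0.
by exists d' => // w /fd /gd.
Qed.

Lemma cdiff_ccont f z : cdiff f z -> ccont f z.
Proof.
move=> [s sz fs].
apply: (@eq_ccont (fun w => f z + s w * (w + - z))).
  by move=> w; rewrite -fs addrC subrK.
apply: ccontD; first exact: ccont_cst.
apply: ccontM => //; apply: ccontD; [exact: ccont_id | exact: ccont_cst].
Qed.

Lemma cdiff_cst c z : cdiff (fun=> c) z.
Proof. by exists (fun=> 0) => [|w]; [exact: ccont_cst | rewrite subrr mul0r]. Qed.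

Lemma cdiff_id z : cdiff id z.
Proof. by exists (fun=> 1) => [|w]; [exact: ccont_cst | rewrite mul1r]. Qed.

Lemma cdiffD f g z : cdiff f z -> cdiff g z -> cdiff (fun w => f w + g w) z.
Proof.
move=> [s sz fs] [t tz gt]; exists (fun w => s w + t w); first exact: ccontD.
by move=> w; rewrite mulrDl -fs -gt; ring.
Qed.

Lemma cdiffM f g z : cdiff f z -> cdiff g z -> cdiff (fun w => f w * g w) z.
Proof.
move=> fz gz; have cg := cdiff_ccont gz.
case: fz gz => s sz fs [t tz gt].
exists (fun w => s w * g w + f z * t w).
  by apply: ccontD; apply: ccontM => //; exact: ccont_cst.
move=> w; rewrite mulrDl [s w * _ * _]mulrAC -fs -mulrA -gt; ring.
Qed.

Lemma cdiffB f g z : cdiff f z -> cdiff g z -> cdiff (fun w => f w - g w) z.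
Proof.
move=> fz gz; apply: (@eq_cdiff (fun w => f w + (-1) * g w)).
  by move=> w; rewrite mulN1r.
by apply: cdiffD => //; apply: cdiffM => //; exact: cdiff_cst.
Qed.

Lemma cdiffX f n z : cdiff f z -> cdiff (fun w => f w ^+ n) z.
Proof.
move=> fz; elim: n => [|n IH]; first exact: cdiff_cst.
apply: (@eq_cdiff (fun w => f w * f w ^+ n)); first by move=> w; rewrite exprS.
exact: cdiffM.
Qed.

(* Where [f w = 0], the slope has to account for the junk value [0^-1 = 0]. *)
Lemma cdiffV f z : f z != 0 -> cdiff f z -> cdiff (fun w => (f w)^-1) z.
Proof.
move=> fz0 fz; have cf := cdiff_ccont fz; case: fz => s sz fs.
pose t w := - (s w * ((f w)^-1 * (f z)^-1)).
pose t' w := if f w == 0 then - (f z)^-1 / (w - z) else t w.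
have [d d0 fd] : exists2 d : R, 0 < d & forall w, normc (w - z) < d -> f w != 0.
  have [|d d0 fd] := cf (normc (f z)); first by rewrite normc_gt0.
  exists d => // w /fd; apply: contraTneq => ->.
  by rewrite sub0r normc_opp ltxx.
exists t'.
  have ct : ccont t z.
    apply: (@eq_ccont (fun w => (-1) * (s w * ((f w)^-1 * (f z)^-1)))).
      by move=> w; rewrite mulN1r.
    apply: ccontM; first exact: ccont_cst.
    apply: ccontM => //; apply: ccontM; last exact: ccont_cst.
    exact: ccontV.
  move=> e /ct[d' d'0 td]; exists (Num.min d d'); first by rewrite lt_min d0.
  move=> w; rewrite lt_min => /andP[/fd fw /td].
  by rewrite /t' (negbTE fw) (negbTE fz0).
move=> w; rewrite /t' /t; case: eqP => [fw0|/eqP fw0].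
  have wz : w - z != 0.
    by rewrite subr_eq0; apply: contraNneq fz0 => <-; rewrite fw0.
  by rewrite fw0 invr0 sub0r divfK.
have -> : - (s w * ((f w)^-1 / f z)) * (w - z) =
  - (s w * (w - z)) * ((f w)^-1 / f z) by ring.
by rewrite -fs; field; rewrite fw0 fz0.
Qed.

Lemma cdiff_div f g z : g z != 0 -> cdiff f z -> cdiff g z ->
  cdiff (fun w => f w / g w) z.
Proof. by move=> g0 fz gz; apply: cdiffM => //; exact: cdiffV. Qed.

Lemma cdiff_comp f g z : cdiff f z -> cdiff g (f z) -> cdiff (fun w => g (f w)) z.
Proof.
move=> fz; have cf := cdiff_ccont fz; case: fz => s sz fs [t tz gt].
exists (fun w => t (f w) * s w).
  by apply: ccontM => //; apply: (@ccont_comp f t).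
by move=> w; rewrite gt fs mulrA.
Qed.

End Differentiability.

(** * From derivatives as limits to Caratheodory slopes *)

Section Derivable.
Variable R : realType.
Local Notation C := (R[i])^o.

Lemma ltc_normc (z : R[i]) (e : R) : (`|z| < e%:C) = (normc z < e).
Proof. by rewrite [LHS]ltcR. Qed.

Lemma derivable_cdiff (f : C -> C) (z : C) : derivable f z 1 -> cdiff f z.
Proof.
rewrite /derivable => /cvg_ex[/= c] /cvgrPdist_lt fc.
exists (fun w => if w == z then c else (f w - f z) / (w - z)); last first.
  move=> w; case: eqP => [->|/eqP wz]; first by rewrite !subrr mulr0.
  by rewrite divfK // subr_eq0.
move=> e e0.
have /fc : 0 < e%:C by rewrite ltcR.
rewrite near_withinE => /nbhs_normP[d /= d0 fd].
(* A positive element of [R[i]] is real, so the complex radius [d] comes from a real one. *)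
have dE : d = (complex.Re d)%:C.
  by case: d d0 {fd} => x y; rewrite ltcE /= => /andP[/eqP -> _].
exists (complex.Re d); first by move: d0; rewrite ltcE => /andP[].
move=> w wd; rewrite eqxx; case: eqP => [_|/eqP wz].
  by rewrite subrr ComplexField.Normc.normc0.
have := fd (w - z); rewrite /ball_ /= sub0r normrN.
have -> : `|w - z| < d by rewrite dE ltc_normc.
rewrite subr_eq0 => /(_ isT wz); rewrite ltc_normc distcC.
suff -> : (w - z)^-1 *: (f ((w - z)%:A + z) - f z) = (f w - f z) / (w - z) by [].
by rewrite [LHS]mulrC [_%:A]mulr1 subrK.
Qed.

End Derivable.

(** * Goursat's theorem for Riemann sums *)

Lemma expr_small (R : realType) (q e : R) : 0 <= q < 1 -> 0 < e ->
  exists n : nat, q ^+ n < e.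
Proof.
move=> /andP[q0 q1] e0.
have /cvgrPdist_lt/(_ _ e0)[n _ nP'] : q ^+ n @[n --> \oo] --> (0 : R).
  by apply: cvg_expr; rewrite ger0_norm.
exists n; have := nP' n (leqnn n) => /=.
by rewrite sub0r normrN ger0_norm // exprn_ge0.
Qed.

Section Rectangles.
Variable R : realType.

(* Bisection: [P x y t] speaks of the rectangle with lower left corner [(x, y)]
   and sides [t * a], [t * b]. *)
Lemma rectangle_induction (P : R -> R -> R -> Prop) (x0 y0 a b : R) :
  0 <= a -> 0 <= b ->
  (forall x y t, 0 < t ->
     P x y (t / 2) -> P (x + t / 2 * a) y (t / 2) ->
     P x (y + t / 2 * b) (t / 2) ->
     P (x + t / 2 * a) (y + t / 2 * b) (t / 2) -> P x y t) ->
  (forall u v, x0 <= u <= x0 + a -> y0 <= v <= y0 + b ->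
     exists2 d : R, 0 < d & forall x y t, 0 < t -> t < d ->
       x <= u <= x + t * a -> y <= v <= y + t * b -> P x y t) ->
  P x0 y0 1.
Proof.
move=> a0 b0 Psplit Ploc; apply: contrapT => nP.
pose S := (R * R * R)%type.
pose bad (s : S) := 0 < s.2 /\ ~ P s.1.1 s.1.2 s.2.
pose step (s s' : S) := [/\ s'.2 = s.2 / 2, s.1.1 <= s'.1.1,
  s'.1.1 + s'.2 * a <= s.1.1 + s.2 * a, s.1.2 <= s'.1.2 &
  s'.1.2 + s'.2 * b <= s.1.2 + s.2 * b].
(* If no quarter of a bad rectangle were bad, [Psplit] would make the rectangle good. The
   implication inside the existential makes the successor total, as [choice] requires. *)
have next s : exists s', bad s -> bad s' /\ step s s'.
  have [[t0 bs]|nb] := pselect (bad s); last by exists s.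
  apply: contrapT => /forallNP H; apply: bs.
  case: s t0 H => [[x y] t] /= t0 H.
  have t20 : 0 < t / 2 by lra.
  have ta : 0 <= t / 2 * a by rewrite mulr_ge0 // ltW.
  have tb : 0 <= t / 2 * b by rewrite mulr_ge0 // ltW.
  have good s' : step (x, y, t) s' -> s'.2 = t / 2 -> P s'.1.1 s'.1.2 s'.2.
    move=> st s'E; apply: contrapT => nP'; apply: (H s') => _.
    by have s'0 : 0 < s'.2 by rewrite s'E.
  apply: Psplit => //.
  - by apply: (good (x, y, t / 2)) => //; split => //=; lra.
  - by apply: (good (x + t / 2 * a, y, t / 2)) => //; split => //=; lra.
  - by apply: (good (x, y + t / 2 * b, t / 2)) => //; split => //=; lra.
  - by apply: (good (x + t / 2 * a, y + t / 2 * b, t / 2)) => //; split => //=; lra.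
have [f fP] := choice next.
pose s n := iter n f (x0, y0, 1).
have bs n : bad (s n).
  elim: n => [|n /fP[] //]; split => //=; exact: ltr01.
have ss n : step (s n) (s n.+1) by have [] := fP _ (bs n).
have t_s n : (s n).2 = 2^-1 ^+ n.
  elim: n => [//|n IH]; have [-> _ _ _ _] := ss n.
  by rewrite IH exprSr.
(* Nested intervals: every left end lies below every right end, so the supremum of the left ends
   belongs to all of them. *)
have mono (c : S -> R) (e : R) : 0 <= e ->
    (forall n, c (s n) <= c (s n.+1)) ->
    (forall n, c (s n.+1) + (s n.+1).2 * e <= c (s n) + (s n).2 * e) ->
    exists u, forall n, c (s n) <= u <= c (s n) + (s n).2 * e.
  move=> e0 c1 c2.
  have up m n : (m <= n)%N -> c (s m) <= c (s n).
    by move=> /subnK <-; elim: (n - m)%N => [//|k IH]; exact: le_trans (c1 _).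
  have down m n : (m <= n)%N -> c (s n) + (s n).2 * e <= c (s m) + (s m).2 * e.
    by move=> /subnK <-; elim: (n - m)%N => [//|k IH]; exact: le_trans (c2 _) _.
  have cross m n : c (s m) <= c (s n) + (s n).2 * e.
    have te k : 0 <= (s k).2 * e by rewrite mulr_ge0 // ltW //; case: (bs k).
    case: (leqP m n) => [/up mn|/ltnW/down mn].
      by apply: (le_trans mn); rewrite lerDl.
    by apply: le_trans mn; rewrite lerDl.
  have hs : has_sup (range (fun n => c (s n))).
    split; first by exists (c (s 0)), 0%N.
    by exists (c (s 0) + (s 0).2 * e) => _ [n _ <-]; exact: cross.
  exists (sup (range (fun n => c (s n)))) => n; apply/andP; split.
    by apply: sup_upper_bound => //; exists n.
  by apply: sup_le_ub; [exact: hs.1 | move=> _ [m _ <-]; exact: cross].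
have [u uP] : exists u, forall n, (s n).1.1 <= u <= (s n).1.1 + (s n).2 * a.
  by apply: (mono (fun p => p.1.1)) => // n; have [] := ss n.
have [v vP] : exists v, forall n, (s n).1.2 <= v <= (s n).1.2 + (s n).2 * b.
  by apply: (mono (fun p => p.1.2)) => // n; have [] := ss n.
have [||d d0 dP] := Ploc u v.
- by have := uP 0%N; rewrite /= mul1r.
- by have := vP 0%N; rewrite /= mul1r.
have [|n nd] := @expr_small R 2^-1 d _ d0.
  by rewrite invr_ge0 ler0n invf_lt1 // ltr1n.
have [tn0] := bs n; apply; apply: dP => //.
by rewrite t_s.
Qed.

End Rectangles.

(** * Contour sums around rectangles *)

Section Goursat.
Variable R : realType.
Implicit Types (h : R -> R[i]) (g : R[i] -> R[i]).

(* The mean of [h] over [2 ^ n] equally spaced points of [[x, x + l[]. *)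
Fixpoint dmean n h (x l : R) : R[i] :=
  if n is m.+1 then (dmean m h x (l / 2) + dmean m h (x + l / 2) (l / 2)) / 2
  else h x.

Lemma dmeanB n h k x l :
  dmean n (fun t => h t - k t) x l = dmean n h x l - dmean n k x l.
Proof. by elim: n x l => //= n IH x l; rewrite !IH; field. Qed.

(** A mean is a convex combination of values, and balls are convex. *)
Lemma dmean_dist n h x l c (M : R) : 0 <= l ->
  (forall t, x <= t <= x + l -> normc (h t - c) <= M) ->
  normc (dmean n h x l - c) <= M.
Proof.
elim: n x l => [|n IH] x l l0 hM /=; first by apply: hM; lra.
have -> : (dmean n h x (l / 2) + dmean n h (x + l / 2) (l / 2)) / 2 - c =
   ((dmean n h x (l / 2) - c) + (dmean n h (x + l / 2) (l / 2) - c)) / 2%:R%:C.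
  by rewrite rmorph_nat; field.
rewrite normc_div normc_real ger0_norm // ler_pdivrMr //.
rewrite (le_trans (normcD _ _)) // (_ : M * 2 = M + M); last by lra.
by apply: lerD; apply: IH => [|t ht]; try apply: hM; lra.
Qed.

(* Riemann sums of the contour integral of [g] around a rectangle. *)
Definition contour n g (x y a b : R) : R[i] :=
  'i * b%:C * (dmean n (fun t => g ((x + a) +i* t)) y b
               - dmean n (fun t => g (x +i* t)) y b)
  - a%:C * (dmean n (fun s => g (s +i* (y + b))) x a
            - dmean n (fun s => g (s +i* y)) x a).

(** The sums over the inner edges of the four quarters cancel in pairs. A mean over a full edge
    averages the means over its halves one level lower, hence the shift from [n.+1] to [n]. *)
Lemma contourS n g x y a b : contour n.+1 g x y a b =
  contour n g x y (a / 2) (b / 2) + contour n g (x + a / 2) y (a / 2) (b / 2) +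
  contour n g x (y + b / 2) (a / 2) (b / 2) +
  contour n g (x + a / 2) (y + b / 2) (a / 2) (b / 2).
Proof.
have half (u : R) : (u / 2)%:C = u%:C / 2 by rewrite rmorphM fmorphV rmorph_nat.
have xa : x + a / 2 + a / 2 = x + a by lra.
have yb : y + b / 2 + b / 2 = y + b by lra.
rewrite /contour /= xa yb !half.
by field.
Qed.

(** For an affine [g] of slope [c] the opposite sides differ by exactly [c * a] and [c * 'i * b],
    and the two contributions cancel. An error [M] in [g] changes each difference by at most
    [2 * M]. *)
Lemma contour_small n g x y a b w c (M : R) : 0 <= a -> 0 <= b ->
  (forall s t, x <= s <= x + a -> y <= t <= y + b ->
    normc (g (s +i* t) - w - c * (s +i* t)) <= M) ->
  normc (contour n g x y a b) <= 2 * (a + b) * M.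
Proof.
move=> a0 b0 gM; rewrite /contour -!dmeanB.
set dx := dmean n _ y b; set dy := dmean n _ x a.
have hx : normc (dx - c * a%:C) <= M + M.
  apply: dmean_dist => // t ht.
  have -> : g ((x + a) +i* t) - g (x +i* t) - c * a%:C =
      (g ((x + a) +i* t) - w - c * ((x + a) +i* t)) -
      (g (x +i* t) - w - c * (x +i* t)).
    have -> : (x + a) +i* t = x +i* t + a%:C by simpc.
    by ring.
  by rewrite (le_trans (normcB _ _)) // lerD // gM //; lra.
have hy : normc (dy - c * ('i * b%:C)) <= M + M.
  apply: dmean_dist => // s hs.
  have -> : g (s +i* (y + b)) - g (s +i* y) - c * ('i * b%:C) =
      (g (s +i* (y + b)) - w - c * (s +i* (y + b))) -
      (g (s +i* y) - w - c * (s +i* y)).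
    have -> : s +i* (y + b) = s +i* y + 'i * b%:C by simpc.
    by ring.
  by rewrite (le_trans (normcB _ _)) // lerD // gM //; lra.
have -> : 'i * b%:C * dx - a%:C * dy =
    'i * b%:C * (dx - c * a%:C) - a%:C * (dy - c * ('i * b%:C)) by ring.
have i1 : normc ('i : R[i]) = 1 by rewrite /= expr0n add0r expr1n sqrtr1.
rewrite (le_trans (normcB _ _)) // !ComplexField.Normc.normcM i1 mul1r.
rewrite !normc_real !ger0_norm //.
have := ler_wpM2l b0 hx; have := ler_wpM2l a0 hy; lra.
Qed.

(** Close to a point [g] is affine up to a small multiple of the diameter, so small rectangles have
    contour sums small in proportion to their area; bisection carries this bound to the whole
    rectangle. *)
Lemma goursat g (x0 y0 a b e : R) : 0 < a -> 0 < b -> 0 < e ->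
  (forall u v, x0 <= u <= x0 + a -> y0 <= v <= y0 + b -> cdiff g (u +i* v)) ->
  exists N, forall n, (N <= n)%N -> normc (contour n g x0 y0 a b) <= e.
Proof.
move=> a0 b0 e0 dg.
(* The bound scales like the area, so that the bounds of four quarters add up exactly to that of the
   whole. *)
pose P x y t := exists N, forall n, (N <= n)%N ->
  normc (contour n g x y (t * a) (t * b)) <= e * t ^+ 2.
suff [N NP] : P x0 y0 1 by exists N => n /NP; rewrite !mul1r expr1n mulr1.
apply: (@rectangle_induction R P x0 y0 a b); rewrite ?ltW //.
  move=> x y t t0 [N1 h1] [N2 h2] [N3 h3] [N4 h4].
  exists (N1 + N2 + N3 + N4).+1 => -[//|n]; rewrite ltnS => Nn.
  have E c : t * c / 2 = t / 2 * c by lra.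
  rewrite contourS !E.
  have {}h1 := h1 n ltac:(lia); have {}h2 := h2 n ltac:(lia).
  have {}h3 := h3 n ltac:(lia); have {}h4 := h4 n ltac:(lia).
  rewrite (le_trans (normcD _ _)) // (le_trans (lerD (normcD _ _) (lexx _))) //.
  rewrite (le_trans (lerD (lerD (normcD _ _) (lexx _)) (lexx _))) //.
  nra.
move=> u v hu hv; have [s sz gs] := dg u v hu hv.
(* Chosen so that [contour_small], with perimeter factor [2 * t * (a + b)] and error
   [e' * t * (a + b)], yields exactly [e * t ^+ 2]. *)
pose e' := e / (2 * (a + b) ^+ 2).
have e'0 : 0 < e' by rewrite divr_gt0 // mulr_gt0 // exprn_gt0 // addr_gt0.
have [d d0 sd] := sz _ e'0.
exists (d / (a + b)); first by rewrite divr_gt0 // addr_gt0.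
move=> x y t t0; rewrite ltr_pdivlMr ?addr_gt0 // => td xu yv.
exists 0%N => n _.
pose z := u +i* v.
have ta : 0 < t * a by rewrite mulr_gt0.
have tb : 0 < t * b by rewrite mulr_gt0.
have -> : e * t ^+ 2 = 2 * (t * a + t * b) * (e' * (t * (a + b))).
  by rewrite /e'; field; rewrite gt_eqF // addr_gt0.
apply: (@contour_small _ _ _ _ _ _ (g z - s z * z) (s z)); rewrite ?ltW //.
move=> p q hp hq.
have -> : g (p +i* q) - (g z - s z * z) - s z * (p +i* q) =
  (s (p +i* q) - s z) * (p +i* q - z).
  by rewrite mulrBl -gs -/z; ring.
have le : normc (p +i* q - z) <= t * (a + b).
  rewrite (le_trans (normc_le_ReIm _)) //= mulrDr lerD // ler_norml; lra.
rewrite ComplexField.Normc.normcM ler_pM ?normc_ge0 //.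
by rewrite ltW // sd // (le_lt_trans le).
Qed.

End Goursat.

(** * The maximum modulus principle *)

Section ComplexExponential.
Variable R : realType.

Lemma is_derive_near (f : R -> R) (x a e : R) : is_derive x 1 f a -> 0 < e ->
  exists2 d : R, 0 < d &
    forall h, `|h| < d -> `|f (x + h) - f x - a * h| <= e * `|h|.
Proof.
move=> [/cvg_ex[/= l fl] fa] e0.
have {fa} la : l = a by rewrite -fa; apply/esym/cvg_lim.
move: fl; rewrite la => /cvgrPdist_lt/(_ _ e0).
rewrite near_withinE => /nbhs_normP[d /= d0 fd].
exists d => // h hd; have [->|h0] := eqVneq h 0.
  by rewrite addr0 subrr mulr0 subrr normr0 mulr0.
have := fd h; rewrite /ball_ /= sub0r normrN => /(_ hd h0)/ltW.
rewrite -(ler_pM2r (_ : 0 < `|h|)) ?normr_gt0 // -normrM.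
suff -> : (a - h^-1 *: (f (h%:A + x) - f x)) * h = - (f (x + h) - f x - a * h).
  by rewrite normrN.
by rewrite [h%:A]mulr1 -[h^-1 *: _]/(h^-1 * _) [x + h]addrC; field.
Qed.

Definition cexp (w : R[i]) : R[i] :=
  (expR (complex.Re w))%:C * (cos (complex.Im w) +i* sin (complex.Im w)).

Lemma normc_cexp w : normc (cexp w) = expR (complex.Re w).
Proof.
rewrite ComplexField.Normc.normcM normc_real ger0_norm ?expR_ge0 //=.
by rewrite cos2Dsin2 sqrtr1 mulr1.
Qed.

Lemma cexpD v w : cexp (v + w) = cexp v * cexp w.
Proof.
case: v w => [a b] [c d]; rewrite /cexp /= expRD cosD sinD.
by simpc; congr (_ +i* _); ring.
Qed.

(** The derivative of [cexp] at 0 is 1, with an explicit remainder, assembled from the real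
    derivatives of [expR], [cos] and [sin] at 0. *)
Lemma cexp_near0 (e : R) : 0 < e -> exists2 d : R, 0 < d &
  forall h, normc h < d -> normc (cexp h - 1 - h) <= e * normc h.
Proof.
move=> e0.
(* The four remainders below total at most [6 * e' * N]; having [e' <= 1] keeps [expR a] at most
   2. *)
pose e' := Num.min (e / 6) 1.
have e'0 : 0 < e' by rewrite lt_min divr_gt0 ?ltr01.
have [e'1 e'6] : e' <= 1 /\ e' <= e / 6.
  by rewrite /e' ge_min lexx orbT ge_min lexx.
have [d1 d10 hexp] := is_derive_near (is_derive_expR 0) e'0.
have [d2 d20 hcos] := is_derive_near (is_derive_cos 0) e'0.
have [d3 d30 hsin] := is_derive_near (is_derive_sin 0) e'0.
exists (Num.min (Num.min d1 d2) (Num.min d3 (e' / 2))).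
  by rewrite !lt_min d10 d20 d30 divr_gt0.
move=> h; rewrite !lt_min => /andP[/andP[hd1 hd2] /andP[hd3 hd4]].
move: hd1 hd2 hd3 hd4 (Re_le_normc h) (Im_le_normc h) (normc_ge0 h).
move: (normc h) => N; case: h => a b hd1 hd2 hd3 hd4.
rewrite [complex.Re _]/= [complex.Im _]/= => hR hI N0.
have {hexp} := hexp a (le_lt_trans hR hd1).
have {hcos} := hcos b (le_lt_trans hI hd2).
have {hsin} := hsin b (le_lt_trans hI hd3).
rewrite !add0r expR0 cos0 sin0 oppr0 mul0r !mul1r !subr0 !addr0.
move=> hsin hcos hexp.
have {}hexp : `|expR a - 1 - a| <= e' * N by rewrite (le_trans hexp) // ler_pM2l.
have {}hcos : `|cos b - 1| <= e' * N by rewrite (le_trans hcos) // ler_pM2l.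
have {}hsin : `|sin b - b| <= e' * N by rewrite (le_trans hsin) // ler_pM2l.
have E1 : `|expR a - 1| <= e'.
  have -> : expR a - 1 = (expR a - 1 - a) + a by ring.
  by rewrite (le_trans (ler_normD _ _)) //; nra.
have E2 : 0 <= expR a <= 2 by rewrite expR_ge0 /=; move: E1; rewrite ler_norml; lra.
have -> : cexp (a +i* b) - 1 - (a +i* b) =
  ((expR a - 1 - a) + expR a * (cos b - 1)) +i*
  (expR a * (sin b - b) + (expR a - 1) * b).
  by rewrite /cexp /=; simpc; congr (_ +i* _); ring.
rewrite (le_trans (normc_le_ReIm _)) //=.
have m1 : `|expR a * (cos b - 1)| <= 2 * (e' * N).
  by rewrite normrM ler_pM // ger0_norm; lra.
have m2 : `|expR a * (sin b - b)| <= 2 * (e' * N).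
  by rewrite normrM ler_pM // ger0_norm; lra.
have m3 : `|(expR a - 1) * b| <= e' * N by rewrite normrM ler_pM.
have := ler_normD (expR a - 1 - a) (expR a * (cos b - 1)).
have := ler_normD (expR a * (sin b - b)) ((expR a - 1) * b).
have : e' * N <= e / 6 * N by rewrite ler_wpM2r.
lra.
Qed.

Lemma cdiff_cexp w : cdiff cexp w.
Proof.
exists (fun v => if v == w then cexp w else (cexp v - cexp w) / (v - w)).
  move=> e e0; have c0 : 0 < normc (cexp w) by rewrite normc_cexp expR_gt0.
  have [|d d0 hd] := @cexp_near0 (e / (2 * normc (cexp w))).
    by rewrite divr_gt0 // mulr_gt0.
  exists d => // v vd; rewrite eqxx; case: eqP => [_|/eqP vw].
    by rewrite subrr ComplexField.Normc.normc0.
  have vw0 : v - w != 0 by rewrite subr_eq0.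
  have -> : (cexp v - cexp w) / (v - w) - cexp w =
      cexp w * (cexp (v - w) - 1 - (v - w)) / (v - w).
    have -> : cexp v = cexp w * cexp (v - w) by rewrite -cexpD addrC subrK.
    by field.
  rewrite normc_div ComplexField.Normc.normcM.
  have n0 : 0 < normc (v - w) by rewrite normc_gt0.
  rewrite ltr_pdivrMr // (le_lt_trans (ler_wpM2l (ltW c0) (hd _ vd))) //.
  have -> : normc (cexp w) * (e / (2 * normc (cexp w)) * normc (v - w)) =
     e * normc (v - w) / 2 by field; rewrite gt_eqF.
  have : 0 < e * normc (v - w) by rewrite mulr_gt0.
  lra.
move=> v; case: eqP => [->|/eqP vw]; first by rewrite !subrr mulr0.
by rewrite divfK // subr_eq0.
Qed.

End ComplexExponential.

(** * Mean values, Blaschke factors and removable singularities *)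

Section MaximumModulus.
Variable R : realType.
Implicit Types (f u :  R[i] -> R[i]) (r M K : R).

(* Goursat's theorem for [f (r * cexp w)] on the rectangle [-t, 0] x [0, 2 pi]
   compares the means of [f] over the circles of radii [r * exp (- t)] and [r]. *)
Lemma mean_value_le f r M : 0 < r -> (forall z, normc z <= r -> cdiff f z) ->
  (forall z, normc z = r -> normc (f z) <= M) -> normc (f 0) <= M.
Proof.
move=> r0 df fM; apply/ler_addgt0Pl => e e0.
have e20 : 0 < e / 2 by rewrite divr_gt0.
have [|d d0 fd] := cdiff_ccont (df 0 _) e20.
  by rewrite ComplexField.Normc.normc0 ltW.
(* Since [expR t >= 1 + t > r / d], the inner circle of radius [r * expR (- t)] lies where [f] is
   within [e / 2] of [f 0]. *)
pose t := r / d; have t0 : 0 < t by rewrite divr_gt0.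
pose g w := f (r%:C * cexp w).
have nr w : normc (r%:C * cexp w) = r * expR (complex.Re w).
  by rewrite ComplexField.Normc.normcM normc_cexp normc_real ger0_norm // ltW.
have dg (x y : R) : - t <= x <= - t + t -> 0 <= y <= 0 + pi *+ 2 ->
    cdiff g (x +i* y).
  move=> /andP[_ x0] _; apply: (@cdiff_comp _ (fun w => r%:C * cexp w) f).
    by apply: cdiffM; [exact: cdiff_cst | exact: cdiff_cexp].
  apply: df; rewrite nr /= -[leRHS]mulr1 ler_pM2l // -expR0 ler_expR; lra.
have pi20 : 0 < pi *+ 2 :> R by rewrite mulrn_wgt0 // pi_gt0.
have e30 : 0 < pi *+ 2 * (e / 2) by rewrite mulr_gt0.
have [n /(_ n (leqnn n))] := goursat t0 pi20 e30 dg.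
rewrite /contour.
(* By periodicity the two horizontal sides carry the same values and cancel; only the vertical
   sides, that is the two circles, remain. *)
have -> : (fun s => g (s +i* (0 + pi *+ 2))) = (fun s => g (s +i* 0)).
  by apply/funext => s; rewrite /g /cexp /= add0r cos2pi sin2pi cos0 sin0.
rewrite subrr mulr0 subr0 ComplexField.Normc.normcM.
have -> : normc ('i * (pi *+ 2)%:C : R[i]) = pi *+ 2.
  rewrite ComplexField.Normc.normcM normc_real ger0_norm ?ltW //.
  by rewrite /= expr0n add0r expr1n sqrtr1 mul1r.
rewrite ler_pM2l // addNr.
(* [A] is the mean over the circle of radius [r], [B] the mean over the inner circle. *)
set A := dmean n _ _ _; set B := dmean n _ _ _ => AB.
have hA : normc (A - 0) <= M.
  apply: dmean_dist => [|s _]; first by rewrite ltW.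
  by rewrite subr0 /g fM // nr /= expR0 mulr1.
have hB : normc (B - f 0) <= e / 2.
  apply: dmean_dist => [|s _]; first by rewrite ltW.
  rewrite ltW // /g fd // subr0 nr /= expRN ltr_pdivrMr ?expR_gt0 //.
  have := expR_ge1Dx t; rewrite -(ler_pM2l d0); apply: lt_le_trans.
  by rewrite /t mulrDr mulr1 mulrC divfK ?gt_eqF // ltrDr.
have -> : f 0 = (A - 0) - (A - B) - (B - f 0) by ring.
have := normcB ((A - 0) - (A - B)) (B - f 0).
have := normcB (A - 0) (A - B).
lra.
Qed.


(** The right-hand side is nonnegative on the closed disc, positive inside and zero on the circle;
    the next three comparisons are read off from its sign. *)
Lemma nsq_blaschke r z w : nsq ((r ^+ 2)%:C - conjc w * z) - r ^+ 2 * nsq (z - w) =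
  (r ^+ 2 - nsq z) * (r ^+ 2 - nsq w).
Proof. by case: z w => [a b] [c d]; rewrite /nsq /=; ring. Qed.

Lemma blaschke_le r z w : 0 < r -> normc z <= r -> normc w <= r ->
  r * normc (z - w) <= normc ((r ^+ 2)%:C - conjc w * z).
Proof.
move=> r0 zr wr; rewrite -ler_sqr ?nnegrE ?mulr_ge0 ?normc_ge0 ?(ltW r0) //.
rewrite exprMn !normc_sq -subr_ge0 nsq_blaschke.
by apply: mulr_ge0; rewrite subr_ge0 nsq_le.
Qed.

Lemma blaschke_eq r z w : 0 < r -> normc z = r ->
  normc ((r ^+ 2)%:C - conjc w * z) = r * normc (z - w).
Proof.
move=> r0 zr; apply/eqP; rewrite -(@eqrXn2 _ 2) ?mulr_ge0 ?normc_ge0 ?(ltW r0) //.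
rewrite exprMn !normc_sq -subr_eq0 nsq_blaschke -[nsq z]normc_sq zr.
by rewrite subrr mul0r.
Qed.

Lemma blaschke_lt r z w : 0 < r -> normc z < r -> normc w < r ->
  r * normc (z - w) < normc ((r ^+ 2)%:C - conjc w * z).
Proof.
move=> r0 zr wr; rewrite -ltr_sqr ?nnegrE ?mulr_ge0 ?normc_ge0 ?(ltW r0) //.
rewrite exprMn !normc_sq -subr_gt0 nsq_blaschke.
by apply: mulr_gt0; rewrite subr_gt0 nsq_lt.
Qed.

Lemma blaschke_neq0 r z w : 0 < r -> normc z <= r -> normc w < r ->
  (r ^+ 2)%:C - conjc w * z != 0.
Proof.
move=> r0 zr wr; rewrite -normc_gt0.
have := normcBl (r ^+ 2)%:C (conjc w * z).
rewrite normc_real ger0_norm ?sqr_ge0 // ComplexField.Normc.normcM normc_conj.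
apply: lt_le_trans; rewrite subr_gt0 expr2.
by rewrite (le_lt_trans (ler_wpM2l (normc_ge0 w) zr)) // ltr_pM2r.
Qed.

(* The Moebius map [m] fixes the circle of radius [r] and sends [0] to [z0]. *)
Lemma max_mod f r M : 0 < r -> (forall z, normc z <= r -> cdiff f z) ->
  (forall z, normc z = r -> normc (f z) <= M) ->
  forall z, normc z <= r -> normc (f z) <= M.
Proof.
move=> r0 df fM z0; rewrite le_eqVlt => /orP[/eqP/fM //|z0r].
have nz0 : normc (- z0) < r by rewrite normc_opp.
pose den z := (r ^+ 2)%:C - conjc (- z0) * z.
pose m z := (r ^+ 2)%:C * (z - - z0) / den z.
have den0 z : normc z <= r -> den z != 0 by move=> zr; exact: blaschke_neq0.
have nm z : normc (m z) = r * (r * normc (z - - z0)) / normc (den z).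
  rewrite normc_div ComplexField.Normc.normcM normc_real ger0_norm ?sqr_ge0 //.
  by rewrite mulrA -expr2.
have dm z : normc z <= r -> cdiff m z.
  move=> zr; apply: (@cdiff_div _ (fun w => (r ^+ 2)%:C * (w - - z0)) den).
  - exact: den0.
  - apply: cdiffM; first exact: cdiff_cst.
    by apply: cdiffB; [exact: cdiff_id | exact: cdiff_cst].
  - apply: cdiffB; first exact: cdiff_cst.
    by apply: cdiffM; [exact: cdiff_cst | exact: cdiff_id].
have mr z : normc z <= r -> normc (m z) <= r.
  move=> zr; rewrite nm ler_pdivrMr ?normc_gt0 ?den0 // ler_pM2l //.
  by rewrite blaschke_le // ltW.
have mr1 z : normc z = r -> normc (m z) = r.
  move=> zr; rewrite nm -(blaschke_eq (- z0) r0 zr) mulfK //.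
  by rewrite normc_eq0 den0 // zr.
(* The value of [f] at [z0] is the value of [f \o m] at the centre, where the mean value inequality
   applies. *)
have <- : m 0 = z0.
  rewrite /m /den mulr0 subr0 opprK add0r mulrAC divff ?mul1r //.
  by rewrite -normc_gt0 normc_real normr_gt0 expf_neq0 ?gt_eqF.
apply: (@mean_value_le (fun z => f (m z)) r) => // z zr; last by rewrite fM ?mr1.
by apply: (@cdiff_comp _ m f); [exact: dm | apply: df; exact: mr].
Qed.

(** Constants disappear under [n]-th roots: if [y < x], the powers of [y / x] tend to 0 and fall
    below [c / (C + 1)], where the added 1 covers [C = 0]. *)
Lemma le_of_exprn_le (c C x y : R) : 0 < c -> 0 <= C -> 0 <= y ->
  (forall n, c * x ^+ n <= C * y ^+ n) -> x <= y.
Proof.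
move=> c0 C0 y0 h; rewrite leNgt; apply/negP => yx.
have x0 : 0 < x by exact: le_lt_trans yx.
have [||n] := @expr_small R (y / x) (c / (C + 1)).
- by rewrite divr_ge0 ?(ltW x0) //= ltr_pdivrMr // mul1r.
- by rewrite divr_gt0 // ltr_wpDl.
rewrite expr_div_n ltr_pdivlMr ?ltr_wpDl // mulrAC ltr_pdivrMr ?exprn_gt0 //.
rewrite ltNge => /negP; apply; rewrite (le_trans (h n)) // mulrC ler_wpM2l //.
  by rewrite exprn_ge0.
by rewrite lerDl.
Qed.

(* Isolated singularities at which [u] stays bounded are invisible: the function
   [(z - q)^2 * u z ^ n] is differentiable at [q], and letting [n] grow removes
   the factor [(z - q)^2]. *)
Lemma max_mod_except (S : seq R[i]) u r M K : 0 < r ->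
  {in S, forall q, normc q < r} ->
  (forall z, normc z <= r -> z \notin S -> cdiff u z) ->
  (forall z, normc z <= r -> normc (u z) <= K) ->
  (forall z, normc z = r -> normc (u z) <= M) ->
  forall z, normc z <= r -> z \notin S -> normc (u z) <= M.
Proof.
move=> r0; elim: S u M K => [|q S IH] u M K Sr du uK uM z zr zS.
  by apply: (@max_mod u r) => // w wr; exact: du.
have qr : normc q < r by apply: Sr; rewrite mem_head.
have K0 : 0 <= K.
  apply: le_trans (normc_ge0 (u 0)) (uK _ _).
  by rewrite ComplexField.Normc.normc0 ltW.
have M0 : 0 <= M.
  by apply: le_trans (normc_ge0 (u r%:C)) (uM _ _); rewrite normc_real gtr0_norm.
move: zS; rewrite inE negb_or => /andP[zq zS].
have dist w : normc w <= r -> normc (w - q) <= 2 * r.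
  by move=> wr; have := normcB w q; lra.
apply: (@le_of_exprn_le (normc (z - q) ^+ 2) ((2 * r) ^+ 2)) => //.
- by rewrite exprn_gt0 // normc_gt0 subr_eq0.
- exact: sqr_ge0.
move=> n; rewrite -!normcX -ComplexField.Normc.normcM.
apply: (IH (fun w => (w - q) ^+ 2 * u w ^+ n) _ ((2 * r) ^+ 2 * K ^+ n)) => //.
- by move=> p pS; apply: Sr; rewrite inE pS orbT.
- move=> w wr wS; have [->|wq] := eqVneq w q; last first.
    apply: cdiffM; apply: cdiffX.
      by apply: cdiffB; [exact: cdiff_id | exact: cdiff_cst].
    by apply: du; rewrite // inE negb_or wq.
  (* At [q] the product vanishes and this slope tends to 0, because [u] is bounded by [K]; the
     radius [r - normc q] keeps [v] inside the disc where that bound holds. *)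
  exists (fun v => (v - q) * u v ^+ n); last by move=> v; rewrite subrr; ring.
  move=> e e0; exists (Num.min (r - normc q) (e / (K ^+ n + 1))).
    by rewrite lt_min subr_gt0 qr divr_gt0 // ltr_wpDl // exprn_ge0.
  move=> v; rewrite lt_min ltrBrDr => /andP[vr].
  rewrite ltr_pdivlMr ?ltr_wpDl ?exprn_ge0 // => ve.
  rewrite subrr mul0r subr0 ComplexField.Normc.normcM normcX.
  apply: le_lt_trans ve; rewrite ler_wpM2l ?normc_ge0 //.
  apply: (@le_trans _ _ (K ^+ n)); last by rewrite lerDl.
  rewrite lerXn2r ?nnegrE ?normc_ge0 // uK //.
  by have := normcD (v - q) q; rewrite subrK; lra.
- move=> w wr; rewrite ComplexField.Normc.normcM !normcX.
  apply: ler_pM; rewrite ?exprn_ge0 ?normc_ge0 //.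
    by apply: lerXn2r; rewrite ?nnegrE ?normc_ge0 ?dist // mulr_ge0 // ltW.
  by apply: lerXn2r; rewrite ?nnegrE ?normc_ge0 ?uK.
- move=> w wr; rewrite ComplexField.Normc.normcM !normcX.
  apply: ler_pM; rewrite ?exprn_ge0 ?normc_ge0 //.
    by apply: lerXn2r; rewrite ?nnegrE ?normc_ge0 ?dist ?wr // mulr_ge0 // ltW.
  by apply: lerXn2r; rewrite ?nnegrE ?normc_ge0 ?uM.
Qed.

End MaximumModulus.

(** * Rigidity in the maximum modulus principle *)

Section Compactness.
Variable R : realType.
Implicit Types (f : R[i] -> R[i]) (r : R).

(** Compactness of the disc, obtained by bisecting the circumscribed square: a bound on each quarter
    gives one on the whole. *)
Lemma disc_bounded (F : R[i] -> R) r : 0 < r ->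
  (forall z, normc z <= r -> exists2 d : R, 0 < d & exists K,
     forall w, normc w <= r -> normc (w - z) < d -> F w <= K) ->
  exists K, forall z, normc z <= r -> F z <= K.
Proof.
move=> r0 loc.
pose P (x y t : R) := exists K, forall p q : R,
  x <= p <= x + t * (2 * r) -> y <= q <= y + t * (2 * r) ->
  normc (p +i* q) <= r -> F (p +i* q) <= K.
suff [K KP] : P (- r) (- r) 1.
  exists K => -[p q] pq; apply: KP => //.
    by have := le_trans (Re_le_normc _) pq; rewrite /= ler_norml; lra.
  by have := le_trans (Im_le_normc _) pq; rewrite /= ler_norml; lra.
apply: (@rectangle_induction R P (- r) (- r) (2 * r) (2 * r)); try lra.
  move=> x y t t0 [K1 h1] [K2 h2] [K3 h3] [K4 h4].
  exists (Num.max (Num.max K1 K2) (Num.max K3 K4)) => p q.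
  have tE : t * (2 * r) = t / 2 * (2 * r) + t / 2 * (2 * r) by lra.
  rewrite tE => /andP[xp px] /andP[yq qy] pq; rewrite !le_max.
  case: (leP p (x + t / 2 * (2 * r))) => hp;
    case: (leP q (y + t / 2 * (2 * r))) => hq.
  - by rewrite h1 // ?xp ?yq.
  - by rewrite (h3 p q) ?orbT // ?xp ?(ltW hq) -?addrA.
  - by rewrite (h2 p q) ?orbT // ?yq ?(ltW hp) -?addrA.
  - by rewrite (h4 p q) ?orbT // ?(ltW hp) ?(ltW hq) -?addrA.
move=> u v _ _.
have [d d0 [K dK]] : exists2 d : R, 0 < d & exists K, forall w,
    normc w <= r -> normc (w - u +i* v) < d -> F w <= K.
  case: (leP (normc (u +i* v)) r) => [/loc //|uv].
  (* This neighbourhood of a point outside the closed disc misses the disc, so any bound will do. *)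
  exists (normc (u +i* v) - r); first by rewrite subr_gt0.
  exists 0 => w wr; have := normcBl (u +i* v) w; rewrite distcC; lra.
exists (d / (4 * r)); first by rewrite divr_gt0 // mulr_gt0.
move=> x y t t0; rewrite ltr_pdivlMr ?mulr_gt0 // => td /andP[xu ux] /andP[yv vy].
exists K => p q /andP[xp px] /andP[yq qy] pq; apply: dK => //.
rewrite (le_lt_trans (normc_le_ReIm _)) //=.
have : `|p - u| <= t * (2 * r) by rewrite ler_norml; lra.
have : `|q - v| <= t * (2 * r) by rewrite ler_norml; lra.
lra.
Qed.

(** If the supremum were not attained, the inverse of its gap to [normc (f z)] would be locally
    bounded, hence at most some [L], and [sup A - L^-1] would be a smaller upper bound. *)
Lemma disc_max f r : 0 < r -> (forall z, normc z <= r -> ccont f z) ->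
  exists2 z0, normc z0 <= r & forall z, normc z <= r -> normc (f z) <= normc (f z0).
Proof.
move=> r0 cf.
have [K KP] : exists K, forall z, normc z <= r -> normc (f z) <= K.
  apply: (@disc_bounded (fun z => normc (f z)) r r0) => z zr.
  have [d d0 dK] := ccont_bounded (cf z zr).
  by exists d => //; exists (normc (f z) + 1) => w _ /dK.
pose A := [set normc (f z) | z in [set z | normc z <= r]].
have A0 : A (normc (f 0)).
  by exists 0 => //; rewrite /mkset ComplexField.Normc.normc0 ltW.
have hA : has_sup A.
  by split; [exists (normc (f 0)) | exists K => _ [z zr <-]; exact: KP].
have supA z : normc z <= r -> normc (f z) <= sup A.
  by move=> zr; apply: sup_upper_bound => //; exists z.
apply: contrapT => H.
have lt_sup z : normc z <= r -> normc (f z) < sup A.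
  move=> zr; rewrite lt_neqAle supA // andbT; apply/eqP => E.
  by apply: H; exists z => // w wr; rewrite E supA.
have [L LP] : exists L, forall z, normc z <= r -> (sup A - normc (f z))^-1 <= L.
  apply: (@disc_bounded (fun z => (sup A - normc (f z))^-1) r r0) => z zr.
  have g0 : 0 < (sup A - normc (f z)) / 2 by have := lt_sup z zr; lra.
  have [d d0 dz] := cf z zr _ g0.
  exists d => //; exists ((sup A - normc (f z)) / 2)^-1 => w wr /dz fw.
  rewrite lef_pV2 ?posrE //; last by rewrite subr_gt0 lt_sup.
  by have := normcBl (f w) (f z); lra.
have L0 : 0 < L.
  have n0 : normc (0 : R[i]) <= r by rewrite ComplexField.Normc.normc0 ltW.
  by rewrite (lt_le_trans _ (LP 0 n0)) // invr_gt0 subr_gt0 lt_sup.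
have : sup A <= sup A - L^-1.
  apply: sup_le_ub; first by exists (normc (f 0)).
  move=> _ [z zr <-]; have := LP z zr; have := lt_sup z zr; rewrite -subr_gt0.
  by move=> g0; rewrite -(lef_pV2 _ _) ?posrE ?invr_gt0 // invrK; lra.
by rewrite lerBrDr gerDl leNgt invr_gt0 L0.
Qed.

Lemma cdiff_bounded f r : 0 < r -> (forall z, normc z <= r -> cdiff f z) ->
  exists K, forall z, normc z <= r -> normc (f z) <= K.
Proof.
move=> r0 df; have [|z _ fz] := @disc_max f r r0; last by exists (normc (f z)).
by move=> z /df/cdiff_ccont.
Qed.

(** Near [p] the slope is bounded; farther away the difference, at most [2 * K], is compared with
    the distance [d]. This bounds the quotients by [z - p] fed to [max_mod_except]. *)
Lemma cdiff_lipschitz_at f r K p : cdiff f p ->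
  (forall z, normc z <= r -> normc (f z) <= K) -> normc p <= r ->
  exists2 C, 0 <= C &
    forall z, normc z <= r -> normc (f z - f p) <= C * normc (z - p).
Proof.
move=> [s sp fs] fK pr.
have [d d0 sd] := ccont_bounded sp.
have K0 : 0 <= K by exact: le_trans (normc_ge0 _) (fK _ pr).
have c1 : 0 <= normc (s p) + 1 by rewrite addr_ge0 // normc_ge0.
have c2 : 0 <= 2 * K / d by rewrite divr_ge0 ?mulr_ge0 // ltW.
exists (normc (s p) + 1 + 2 * K / d); first exact: addr_ge0.
move=> z zr; rewrite mulrDl.
case: (ltP (normc (z - p)) d) => [/sd sz|zd].
  rewrite fs ComplexField.Normc.normcM.
  apply: ler_wpDr; first by rewrite mulr_ge0 ?normc_ge0.
  by rewrite ler_wpM2r ?normc_ge0.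
apply: ler_wpDl; first by rewrite mulr_ge0 ?normc_ge0.
apply: (@le_trans _ _ (2 * K)).
  by have := normcB (f z) (f p); have := fK _ zr; have := fK _ pr; lra.
by rewrite mulrAC ler_pdivlMr // ler_wpM2l ?mulr_ge0.
Qed.

End Compactness.

(** * Equality at an interior point *)

Section Rigidity.
Variable R : realType.
Implicit Types (f u : R[i] -> R[i]) (r : R).

Lemma le0_of_small (x y : R) : (forall t, 0 < t < 1 -> x <= t * y) -> x <= 0.
Proof.
move=> h; rewrite leNgt; apply/negP => x0.
have y0 : 0 <= `|y| by [].
have c0 : 0 < 2 * (x + `|y|) by lra.
have := h (x / (2 * (x + `|y|))); rewrite divr_gt0 //= ltr_pdivrMr //.
have -> : x < 1 * (2 * (x + `|y|)) by lra.
rewrite mulrAC ler_pdivlMr // => /(_ isT).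
have : x * y <= x * `|y| by rewrite ler_pM2l // ler_norm.
nra.
Qed.

(** On the closed unit disc the Moebius map [(1 - v) / (1 - s v)] is largest in modulus at [v = -1],
    with value [2 / (1 + s)]. *)
Lemma normc_1Bs (s : R) (v : R[i]) : 0 < s < 1 -> normc v <= 1 ->
  (1 + s) * normc (1 - v) <= 2 * normc (1 - s%:C * v).
Proof.
move=> /andP[s0 s1] v1.
have s2 : 0 <= 1 + s by lra.
rewrite -ler_sqr ?nnegrE ?mulr_ge0 ?normc_ge0 //.
rewrite !exprMn !normc_sq.
have := nsq_le v1; have : - 1 <= complex.Re v.
  by have := le_trans (Re_le_normc v) v1; rewrite ler_norml => /andP[].
case: v {v1} => x y; rewrite /nsq /= => x1 m1.
rewrite -subr_ge0.
have -> : 2 ^+ 2 * ((1 - (s * x - 0 * y)) ^+ 2 + (0 - (s * y + 0 * x)) ^+ 2) -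
  (1 + s) ^+ 2 * ((1 - x) ^+ 2 + (0 - y) ^+ 2) =
  (1 - s) * (2 * (1 - s) * (x + 1) + (3 * s + 1) * (1 ^+ 2 - (x ^+ 2 + y ^+ 2))).
  by ring.
apply: mulr_ge0; first by lra.
by apply: addr_ge0; apply: mulr_ge0; lra.
Qed.

(* With [u z0 = 1], the function [(1 - u) / (1 - s u)] vanishes at [z0] and is
   bounded by [2 / (1 + s)]; Schwarz's lemma at [z0] and [s -> 1] give [u = 1]. *)
Lemma max_mod_rigid (S : seq R[i]) u r z0 : 0 < r ->
  {in S, forall q, normc q < r} ->
  (forall z, normc z <= r -> z \notin S -> cdiff u z) ->
  (forall z, normc z <= r -> normc (u z) <= 1) ->
  normc z0 < r -> z0 \notin S -> u z0 = 1 ->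
  forall z, normc z < r -> z \notin S -> u z = 1.
Proof.
move=> r0 Sr du u1 z0r z0S uz0 z zr zS.
have [->//|zz0] := eqVneq z z0.
have [C C0 CP] := cdiff_lipschitz_at (du _ (ltW z0r) z0S) u1 (ltW z0r).
rewrite {}uz0 in CP.
pose den w := (r ^+ 2)%:C - conjc z0 * w.
have den_bound w : normc w <= r -> normc (den w) <= 2 * r ^+ 2.
  move=> wr; rewrite (le_trans (normcB _ _)) // normc_real ger0_norm ?sqr_ge0 //.
  rewrite ComplexField.Normc.normcM normc_conj.
  have : normc z0 * normc w <= r * r by rewrite ler_pM ?normc_ge0 // ltW.
  lra.
have su s w : 0 < s < 1 -> normc w <= r -> 1 - s <= normc (1 - s%:C * u w).
  move=> /andP[s0 s1] wr; have := normcBl 1 (s%:C * u w).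
  rewrite ComplexField.Normc.normc1 ComplexField.Normc.normcM normc_real gtr0_norm //.
  have : s * normc (u w) <= s * 1 by rewrite ler_pM2l // u1.
  lra.
have key s : 0 < s < 1 ->
    normc (1 - u z) * normc (den z) * (1 + s) <=
    2 * (r * normc (z - z0)) * normc (1 - s%:C * u z).
  move=> s01; have [s0 s1] := andP s01.
  (* Schwarz quotient: [(1 - u) / (1 - s u)], normalized by [(1 + s) / 2], is divided by the
     Blaschke factor [r (w - z0) / den w], whose modulus is 1 on the circle. The bound [C * (2 * r
     ^+ 2) * 2 / ((1 - s) * (2 * r))] below only has to show that [k] is bounded near [z0]. *)
  pose k w := (1 - u w) * den w * (1 + s)%:C /
     ((1 - s%:C * u w) * (2 * r)%:C * (w - z0)).
  have nk w : normc (k w) = normc (1 - u w) * normc (den w) * (1 + s) /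
     (normc (1 - s%:C * u w) * (2 * r) * normc (w - z0)).
    rewrite normc_div !ComplexField.Normc.normcM !normc_real !ger0_norm //.
      by rewrite mulr_ge0 // ltW.
    by lra.
  have pos w : normc w <= r -> 0 < normc (1 - s%:C * u w) * (2 * r).
    by move=> wr; rewrite !mulr_gt0 //; have := su s w s01 wr; lra.
  have : normc (k z) <= 1.
    apply: (@max_mod_except R (z0 :: S) k r 1
      (C * (2 * r ^+ 2) * 2 / ((1 - s) * (2 * r)))) => //.
    - by move=> q; rewrite inE => /orP[/eqP -> //|/Sr].
    - move=> w wr; rewrite inE negb_or => /andP[wz0 wS].
      have cu := du _ wr wS.
      apply: (@cdiff_div _ (fun w => (1 - u w) * den w * (1 + s)%:C)
        (fun w => (1 - s%:C * u w) * (2 * r)%:C * (w - z0))).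
      + rewrite -normc_gt0 !ComplexField.Normc.normcM normc_real.
        rewrite gtr0_norm; last by rewrite mulr_gt0.
        apply: mulr_gt0; first exact: pos.
        by rewrite normc_gt0 subr_eq0.
      + apply: cdiffM; last exact: cdiff_cst.
        apply: cdiffM; apply: cdiffB; try exact: cdiff_cst; first exact: cu.
        by apply: cdiffM; [exact: cdiff_cst | exact: cdiff_id].
      + apply: cdiffM; last by apply: cdiffB; [exact: cdiff_id | exact: cdiff_cst].
        apply: cdiffM; last exact: cdiff_cst.
        apply: cdiffB; first exact: cdiff_cst.
        by apply: cdiffM; [exact: cdiff_cst | exact: cu].
    - move=> w wr; rewrite nk.
      have [->|wz0] := eqVneq w z0.
        rewrite subrr ComplexField.Normc.normc0 mulr0 invr0 mulr0.
        by rewrite !mulr_ge0 ?invr_ge0 ?sqr_ge0 ?mulr_ge0 //; lra.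
      have d0 : 0 < normc (w - z0) by rewrite normc_gt0 subr_eq0.
      rewrite ler_pdivrMr; last by apply: mulr_gt0 => //; exact: pos.
      have -> : C * (2 * r ^+ 2) * 2 / ((1 - s) * (2 * r)) *
        (normc (1 - s%:C * u w) * (2 * r) * normc (w - z0)) =
        (C * normc (w - z0)) * (2 * r ^+ 2) * 2 * (normc (1 - s%:C * u w) / (1 - s)).
        by field; rewrite !gt_eqF // subr_gt0.
      rewrite -[leLHS]mulr1; apply: ler_pM => //.
      + by rewrite !mulr_ge0 ?normc_ge0 //; lra.
      + apply: ler_pM => //; rewrite ?mulr_ge0 ?normc_ge0 //; try lra.
        apply: ler_pM; rewrite ?normc_ge0 ?den_bound //.
        by rewrite distcC CP.
      + by rewrite ler_pdivlMr ?subr_gt0 // mul1r su.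
    - move=> w wr; rewrite nk ler_pdivrMr.
        rewrite mul1r /den (blaschke_eq z0 r0 wr).
        have wr' : normc w <= r by rewrite wr.
        have rw0 : 0 <= r * normc (w - z0) by rewrite mulr_ge0 ?normc_ge0 // ltW.
        by have := ler_wpM2r rw0 (normc_1Bs s01 (u1 w wr')); lra.
      apply: mulr_gt0; first by rewrite pos ?wr.
      rewrite normc_gt0 subr_eq0.
      by apply: contraTneq z0r => <-; rewrite wr ltxx.
    - by rewrite ltW.
    - by rewrite inE negb_or zz0.
  rewrite nk ler_pdivrMr; first by rewrite mul1r; lra.
  apply: mulr_gt0; first by rewrite pos ?ltW.
  by rewrite normc_gt0 subr_eq0.
apply/eqP; rewrite eq_sym -subr_eq0 -normc_eq0 eq_le normc_ge0 andbT.
(* Strictness in the interior gives [D < normc (den z)]. With [s = 1 - t], the inequality [key]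
   bounds [2 * A * (normc (den z) - D)] by a multiple of [t], which forces [A = 0]. *)
have B := blaschke_lt r0 zr z0r; rewrite -/(den z) in B.
set A := normc (1 - u z) in key *.
set D := r * normc (z - z0) in key B.
have A0 : 0 <= A by exact: normc_ge0.
have D0 : 0 <= D by rewrite mulr_ge0 ?normc_ge0 // ltW.
rewrite -(pmulr_lle0 _ (_ : 0 < 2 * (normc (den z) - D))); last first.
  by rewrite mulr_gt0 // subr_gt0.
apply: (@le0_of_small _ (A * normc (den z) + 2 * D)) => t t01.
have {key} := key (1 - t) ltac:(lra).
have : normc (1 - (1 - t)%:C * u z) <= A + t.
  have -> : 1 - (1 - t)%:C * u z = (1 - u z) + t%:C * u z.
    by rewrite rmorphB rmorph1; ring.
  rewrite (le_trans (normcD _ _)) // lerD2l ComplexField.Normc.normcM normc_real.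
  rewrite gtr0_norm; last by lra.
  by have := u1 z (ltW zr); nra.
move: D0; clear; nra.
Qed.

End Rigidity.

(** * Equality in the Schwarz-Pick inequality *)

Section SchwarzPick.
Variable R : realType.
Implicit Types (f phi : R[i] -> R[i]) (r rho : R).

(** As [f] vanishes near 0, each [f w / w ^+ n] is bounded and satisfies the maximum principle on a
    disc of radius [rho] with [normc z < rho < 1]. Hence [normc (f z) * rho ^+ n <= K * normc z ^+
    n] for all [n], impossible unless [f z = 0]. *)
Lemma unique_continuation f r : 0 < r -> r < 1 ->
  (forall z, normc z < 1 -> cdiff f z) -> (forall z, normc z <= r -> f z = 0) ->
  forall z, normc z < 1 -> f z = 0.
Proof.
move=> r0 r1 df f0 z z1; apply/eqP; rewrite -normc_eq0; apply/eqP.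
case: (leP (normc z) r) => [/f0 ->|rz]; first exact: ComplexField.Normc.normc0.
pose rho := (normc z + 1) / 2.
have [zrho rho1] : normc z < rho /\ rho < 1 by rewrite /rho; lra.
have rho0 : 0 < rho by lra.
have [|K KP] := @cdiff_bounded R f rho rho0; first by move=> w wr; apply: df; lra.
have K0 : 0 <= K by exact: le_trans (normc_ge0 _) (KP z (ltW zrho)).
have z0 : z != 0 by rewrite -normc_gt0; lra.
apply: contrapT => /eqP; rewrite normc_eq0 -normc_gt0 => fz0.
suff : rho <= normc z by lra.
apply: (@le_of_exprn_le R (normc (f z)) K) => // [|n]; first exact: normc_ge0.
have : normc (f z / z ^+ n) <= K / rho ^+ n.
  apply: (@max_mod_except R [:: 0] (fun w => f w / w ^+ n) rho _ (K / r ^+ n)) => //.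
  - by move=> q; rewrite inE => /eqP ->; rewrite ComplexField.Normc.normc0.
  - move=> w wr; rewrite inE => w0; apply: cdiff_div.
    + by rewrite expf_neq0.
    + by apply: df; lra.
    + by apply: cdiffX; exact: cdiff_id.
  - move=> w wr; rewrite normc_div normcX.
    case: (leP (normc w) r) => [/f0 ->|rw].
      rewrite ComplexField.Normc.normc0 mul0r.
      by rewrite divr_ge0 // exprn_ge0 // ltW.
    have w0 : 0 < normc w by lra.
    rewrite ler_pM ?normc_ge0 ?invr_ge0 ?exprn_ge0 ?normc_ge0 ?KP //.
    rewrite lef_pV2 ?posrE ?exprn_gt0 //.
    by apply: lerXn2r; rewrite ?nnegrE ltW.
  - move=> w wr; rewrite normc_div normcX wr ler_pM2r ?KP ?wr //.
    by rewrite invr_gt0 exprn_gt0.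
  - by rewrite ltW.
  - by rewrite inE.
rewrite normc_div normcX ler_pdivlMr ?exprn_gt0 // mulrAC ler_pdivrMr //.
by rewrite exprn_gt0 // normc_gt0.
Qed.

(* The hypothesis rearranges to
   [4 r^2 s t + 2 (s + t) (rho^4 - r^4) + |q + q'|^2 (rho^2 - r^2)^2 <= 0], where
   [s = r^2 - |q|^2] and [t = r^2 - |q'|^2]. *)
Lemma diametral_points rho r (q q' : R[i]) : 0 < r -> r < rho ->
  normc q <= r -> normc q' <= r ->
  2 * r * normc ((rho ^+ 2)%:C - conjc q * q') <=
    (rho ^+ 2 + r ^+ 2) * normc (q' - q) ->
  nsq q = r ^+ 2 /\ q' = - q.
Proof.
move=> r0 rrho /nsq_le qr /nsq_le q'r.
rewrite -ler_sqr ?nnegrE ?mulr_ge0 ?normc_ge0 ?addr_ge0 ?sqr_ge0 ?(ltW r0) //.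
rewrite !exprMn !normc_sq.
case: q q' qr q'r => [a b] [c d]; rewrite /nsq /= => qr q'r h.
set s := r ^+ 2 - (a ^+ 2 + b ^+ 2); set t := r ^+ 2 - (c ^+ 2 + d ^+ 2).
have s0 : 0 <= s by rewrite subr_ge0.
have t0 : 0 <= t by rewrite subr_ge0.
have p2 : 0 < rho ^+ 2 - r ^+ 2 by rewrite subr_gt0 ltr_sqr ?nnegrE; lra.
have r2 : 0 < r ^+ 2 by rewrite exprn_gt0.
have p4 : 0 < rho ^+ 4 - r ^+ 4.
  have -> : rho ^+ 4 - r ^+ 4 =
    (rho ^+ 2 - r ^+ 2) * (rho ^+ 2 - r ^+ 2 + 2 * r ^+ 2) by ring.
  by rewrite mulr_gt0 //; lra.
have n0 : 0 <= (a + c) ^+ 2 + (b + d) ^+ 2 by rewrite addr_ge0 ?sqr_ge0.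
have T1 : 0 <= 4 * r ^+ 2 * (s * t) by rewrite !mulr_ge0 //; lra.
have T2 : 0 <= 2 * (s * (rho ^+ 4 - r ^+ 4)) by rewrite !mulr_ge0 //; lra.
have T3 : 0 <= 2 * (t * (rho ^+ 4 - r ^+ 4)) by rewrite !mulr_ge0 //; lra.
have T4 : 0 <= ((a + c) ^+ 2 + (b + d) ^+ 2) * (rho ^+ 2 - r ^+ 2) ^+ 2.
  by rewrite mulr_ge0 // sqr_ge0.
have T : 4 * r ^+ 2 * (s * t) + 2 * (s * (rho ^+ 4 - r ^+ 4)) +
    2 * (t * (rho ^+ 4 - r ^+ 4)) +
    ((a + c) ^+ 2 + (b + d) ^+ 2) * (rho ^+ 2 - r ^+ 2) ^+ 2 <= 0.
  move: h; rewrite -subr_le0 /s /t; apply: le_trans; rewrite le_eqVlt.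
  by apply/orP; left; apply/eqP; ring.
have E1 : s = 0.
  apply/eqP; have : 2 * (s * (rho ^+ 4 - r ^+ 4)) == 0 by rewrite eq_le; lra.
  by rewrite !mulf_eq0 pnatr_eq0 /= (gt_eqF p4) orbF.
have E2 : (a + c) ^+ 2 + (b + d) ^+ 2 = 0.
  apply/eqP; have : ((a + c) ^+ 2 + (b + d) ^+ 2) * (rho ^+ 2 - r ^+ 2) ^+ 2 == 0.
    by rewrite eq_le; lra.
  by rewrite mulf_eq0 sqrf_eq0 (gt_eqF p2) orbF.
split; first by move: E1; rewrite /s; lra.
move/eqP: E2; rewrite paddr_eq0 ?sqr_ge0 // !sqrf_eq0 !addr_eq0.
move=> /andP[/eqP -> /eqP ->]; apply/eqP.
by rewrite eq_complex /= !opprK !eqxx.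
Qed.

(* Two points of the closed disc of radius [r] mapped to antipodal points of its
   boundary realize the hyperbolic diameter of that disc, so Schwarz-Pick in the
   larger disc is an equality. *)
Lemma rotation_of_antipodal phi rho r q q' : 0 < r -> r < rho ->
  (forall z, normc z <= rho -> cdiff phi z) ->
  (forall z, normc z <= rho -> normc (phi z) <= rho) ->
  normc q <= r -> normc q' <= r -> phi q = r%:C -> phi q' = - r%:C ->
  exists2 c, normc c = 1 & forall z, normc z < rho -> phi z = c * z.
Proof.
move=> r0 rrho dphi phi_le qr q'r phiq phiq'.
have rho0 : 0 < rho by lra.
have qrho : normc q < rho by lra.
have q'rho : normc q' < rho by lra.
have nr : normc r%:C = r by rewrite normc_real gtr0_norm.
have [C C0 CP] := cdiff_lipschitz_at (dphi _ (ltW qrho)) phi_le (ltW qrho).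
rewrite phiq in CP.
pose A z := (rho ^+ 2)%:C - conjc q * z.
pose B z := (rho ^+ 2)%:C - r%:C * phi z.
have rconj : conjc (r%:C) = r%:C :> R[i].
  by apply/eqP; rewrite eq_complex /= oppr0 !eqxx.
have BE z : B z = (rho ^+ 2)%:C - conjc (r%:C) * phi z by rewrite rconj.
have B0 z : normc z <= rho -> 0 < normc (B z).
  by move=> zr; rewrite BE normc_gt0 blaschke_neq0 ?phi_le ?nr.
have B_lb z : normc z <= rho -> rho * (rho - r) <= normc (B z).
  move=> zr; have := normcBl (rho ^+ 2)%:C (r%:C * phi z).
  rewrite normc_real ger0_norm ?sqr_ge0 // ComplexField.Normc.normcM nr.
  by have := ler_wpM2l (ltW r0) (phi_le z zr); rewrite /B; lra.
have A_ub z : normc z <= rho -> normc (A z) <= 2 * rho ^+ 2.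
  move=> zr; rewrite (le_trans (normcB _ _)) // normc_real ger0_norm ?sqr_ge0 //.
  rewrite ComplexField.Normc.normcM normc_conj.
  have : normc q * normc z <= rho * rho by rewrite ler_pM ?normc_ge0 // ltW.
  lra.
(* The Schwarz-Pick quotient: the Blaschke factor at [r] evaluated at [phi z], over the Blaschke
   factor at [q], the common [rho] being cancelled. *)
pose u z := (phi z - r%:C) * A z / (B z * (z - q)).
have nu z : normc (u z) =
    normc (phi z - r%:C) * normc (A z) / (normc (B z) * normc (z - q)).
  by rewrite normc_div !ComplexField.Normc.normcM.
have du z : normc z <= rho -> z \notin [:: q] -> cdiff u z.
  move=> zr; rewrite inE => zq.
  have BB : cdiff B z.
    by apply: cdiffB; [|apply: cdiffM; [|exact: dphi]]; exact: cdiff_cst.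
  apply: (@cdiff_div _ (fun z => (phi z - r%:C) * A z) (fun z => B z * (z - q))).
  - by apply: mulf_neq0; [rewrite -normc_gt0 B0 | rewrite subr_eq0].
  - apply: cdiffM; apply: cdiffB; try exact: cdiff_cst; first exact: dphi.
    by apply: cdiffM; [exact: cdiff_cst | exact: cdiff_id].
  - by apply: cdiffM => //; apply: cdiffB; [exact: cdiff_id | exact: cdiff_cst].
have uK z : normc z <= rho -> normc (u z) <= C * (2 * rho ^+ 2) / (rho * (rho - r)).
  move=> zr; have rr : 0 < rho * (rho - r) by rewrite mulr_gt0 // subr_gt0.
  rewrite nu; have [->|zq] := eqVneq z q.
    rewrite subrr ComplexField.Normc.normc0 mulr0 invr0 mulr0.
    by rewrite !mulr_ge0 ?invr_ge0 ?sqr_ge0 // ltW.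
  have d0 : 0 < normc (z - q) by rewrite normc_gt0 subr_eq0.
  rewrite ler_pdivrMr; last by rewrite mulr_gt0 // B0.
  have -> : C * (2 * rho ^+ 2) / (rho * (rho - r)) * (normc (B z) * normc (z - q)) =
    C * normc (z - q) * (2 * rho ^+ 2) * (normc (B z) / (rho * (rho - r))).
    by field; rewrite !gt_eqF // subr_gt0.
  rewrite -[leLHS]mulr1; apply: ler_pM => //.
  - by rewrite mulr_ge0 ?normc_ge0.
  - by apply: ler_pM; rewrite ?normc_ge0 ?A_ub // CP.
  - by rewrite ler_pdivlMr // mul1r B_lb.
have Sq : {in [:: q], forall p, normc p < rho}.
  by move=> p; rewrite inE => /eqP ->.
have u1 z : normc z <= rho -> normc (u z) <= 1.
  (* At [q] the division by zero gives [u] the value 0. *)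
  move=> zr; have [->|zq] := eqVneq z q.
    by rewrite /u subrr mulr0 invr0 mulr0 ComplexField.Normc.normc0.
  apply: (max_mod_except rho0 Sq du uK) => //; last by rewrite inE.
  move=> w wrho; have wr : normc w <= rho by rewrite wrho.
  have d0 : 0 < normc (w - q).
    rewrite normc_gt0 subr_eq0; apply: contraTneq qrho => <-.
    by rewrite wrho ltxx.
  rewrite nu ler_pdivrMr; last by rewrite mulr_gt0 // B0.
  rewrite mul1r /A (blaschke_eq q rho0 wrho) mulrA ler_pM2r // mulrC BE.
  by rewrite blaschke_le ?phi_le // nr ltW.
have qq' : q' != q.
  apply/eqP => E; move: phiq'; rewrite E phiq => /eqP.
  rewrite -subr_eq0 opprK -normc_eq0 -rmorphD normc_real gtr0_norm; last by lra.
  by rewrite gt_eqF //; lra.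
have q'S : q' \notin [:: q] by rewrite inE.
have Bq' : B q' = (rho ^+ 2 + r ^+ 2)%:C.
  by rewrite /B phiq' mulrN opprK -rmorphM -rmorphD expr2.
have rr0 : 0 < rho ^+ 2 + r ^+ 2 by rewrite addr_gt0 ?exprn_gt0.
(* Since [phi q' = - r], the bound [normc (u q') <= 1] is the hypothesis of [diametral_points]. *)
have [nq q'E] : nsq q = r ^+ 2 /\ q' = - q.
  apply: (diametral_points r0 rrho qr q'r).
  have := u1 q' (ltW q'rho); rewrite nu Bq' normc_real gtr0_norm // phiq'.
  have -> : - r%:C - r%:C = - (2 * r)%:C :> R[i] by rewrite rmorphM rmorph_nat; ring.
  rewrite normc_opp normc_real gtr0_norm ?mulr_gt0 // ler_pdivrMr ?mul1r //.
  by rewrite mulr_gt0 // normc_gt0 subr_eq0.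
have qcq : conjc q * q = (r ^+ 2)%:C by rewrite mul_conjc nq.
have rC0 : r%:C != 0 :> R[i] by rewrite -normc_gt0 nr.
have nqr : normc q = r.
  by apply/eqP; rewrite -(@eqrXn2 _ 2) ?normc_ge0 ?(ltW r0) // normc_sq nq.
have q0 : q != 0 by rewrite -normc_gt0 nqr.
pose c := conjc q / r%:C.
have cq : c * q = r%:C.
  by rewrite /c mulrAC qcq expr2 rmorphM mulfK.
have rc : r%:C * c = conjc q by rewrite /c mulrC divfK.
have nc : normc c = 1 by rewrite normc_div normc_conj nr nqr divff // gt_eqF.
have c0 : c != 0 by rewrite -normc_gt0 nc.
(* Thus [u] reaches modulus 1 at an interior point, and rigidity makes it equal to [c] away from
   [q]. *)
have uq' : u q' = c.
  have Aq' : A q' = B q'.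
    by rewrite Bq' /A q'E mulrN opprK qcq -rmorphD.
  have BN : B q' != 0 by rewrite -normc_gt0 B0 // ltW.
  rewrite /u Aq' phiq' q'E; move: BN; rewrite q'E => BN.
  rewrite -cq; field.
  by rewrite BN -opprD oppr_eq0 -mulr2n mulrn_eq0 q0.
exists c => // z zr.
have main : (phi z - r%:C) * A z = c * (z - q) * B z.
  have [->|zq] := eqVneq z q; first by rewrite phiq !subrr !(mul0r, mulr0).
  have : u z / c = 1.
    apply: (@max_mod_rigid R [:: q] (fun w => u w / c) rho q' rho0 Sq) => //.
    - by move=> w wr wS; apply: cdiffM; [exact: du | exact: cdiff_cst].
    - by move=> w wr; rewrite normc_div nc divr1 u1.
    - by rewrite uq' divff.
    - by rewrite inE.
  move=> /(congr1 (fun x => x * c)); rewrite divfK // mul1r => uz.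
  have BN : B z != 0 by rewrite -normc_gt0 B0 // ltW.
  have zq0 : z - q != 0 by rewrite subr_eq0.
  by rewrite -uz /u; field; rewrite BN zq0.
have D0 : (rho ^+ 2)%:C - r%:C * r%:C != 0 :> R[i].
  rewrite -rmorphM -rmorphB -expr2.
  by rewrite -normc_gt0 normc_real normr_gt0 subr_eq0 eqrXn2 // ?ltW // gt_eqF.
(* The identity [main] is linear in [phi z]; solving it leaves the factor [rho ^+ 2 - r ^+ 2]. *)
apply: (mulIf D0); apply/eqP; rewrite -subr_eq0.
have -> : phi z * ((rho ^+ 2)%:C - r%:C * r%:C) -
    c * z * ((rho ^+ 2)%:C - r%:C * r%:C) =
    ((phi z - r%:C) * A z - c * (z - q) * B z) +
    (c * q - r%:C) * (r%:C * phi z - (rho ^+ 2)%:C).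
  by rewrite /A /B -rc; ring.
by rewrite main cq !subrr mul0r addr0.
Qed.

End SchwarzPick.

(** * Perturbation of a peaking function *)

Section Peak.
Variable R : realType.

(** The affine function peaks at [p]: its modulus is at most [1 - d ^+ 2 / 8] with
    [d = |w - p| / r]. The perturbation is at most [X * d] with [X = C * r * |e|], and
    [X * d <= d ^+ 2 / 8 + 2 * X ^+ 2], so only a second-order term in [e] survives. *)
Lemma peak_bound (p w e v : R[i]) (r C : R) : 0 < r -> normc p = r -> normc w <= r ->
  normc v <= C * normc (w - p) ->
  normc (2^-1 + conjc p / (2 * (r ^+ 2)%:C) * w + e * v) <=
    1 + 2 * (C * r) ^+ 2 * normc e ^+ 2.
Proof.
move=> r0 pr wr vC.
pose d := normc (w - p) / r.
have r2 : (r ^+ 2)%:C != 0 :> R[i].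
  by rewrite -normc_gt0 normc_real normr_gt0 expf_neq0 ?gt_eqF.
have pcp : conjc p * p = (r ^+ 2)%:C by rewrite mul_conjc -normc_sq pr.
pose y := conjc p * w / (r ^+ 2)%:C.
have y1 : normc y <= 1.
  rewrite normc_div ComplexField.Normc.normcM normc_conj pr normc_real.
  rewrite ger0_norm ?sqr_ge0 //.
  by rewrite ler_pdivrMr ?exprn_gt0 // mul1r expr2 ler_pM2l.
have yd : normc (1 - y) = d.
  have -> : 1 - y = conjc p * (p - w) / (r ^+ 2)%:C.
    by rewrite mulrBr pcp mulrBl divff.
  rewrite normc_div ComplexField.Normc.normcM normc_conj pr normc_real.
  rewrite ger0_norm ?sqr_ge0 //.
  by rewrite distcC /d; field; rewrite gt_eqF.
have d0 : 0 <= d by rewrite -yd normc_ge0.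
have -> : 2^-1 + conjc p / (2 * (r ^+ 2)%:C) * w = (1 + y) / 2%:R%:C.
  by rewrite rmorph_nat /y; move: ((r ^+ 2)%:C) r2 => k k0; field; rewrite k0.
have h : normc ((1 + y) / 2%:R%:C) <= 1 - d ^+ 2 / 8.
  have d2 : d <= 2.
    by rewrite -yd; have := normcB 1 y; rewrite ComplexField.Normc.normc1; lra.
  have dd : d ^+ 2 <= 4 by nra.
  rewrite normc_div normc_real ger0_norm // ler_pdivrMr //.
  apply: normc_le; first by lra.
  (* Parallelogram law for [1] and [y]. *)
  have : nsq (1 + y) + d ^+ 2 <= 4.
    rewrite -yd normc_sq; have := nsq_le y1.
    by case: (y) => a b; rewrite /nsq /=; nra.
  have : 0 <= (d ^+ 2) ^+ 2 by exact: sqr_ge0.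
  nra.
rewrite (le_trans (normcD _ _)) // (ComplexField.Normc.normcM e).
have E : normc e * normc v <= (C * r * normc e) * d.
  have -> : C * r * normc e * d = normc e * (C * normc (w - p)).
    by rewrite /d; field; rewrite gt_eqF.
  by rewrite ler_wpM2l ?normc_ge0.
set X := C * r * normc e in E *.
have -> : 2 * (C * r) ^+ 2 * normc e ^+ 2 = 2 * X ^+ 2 by rewrite /X; ring.
have : 0 <= (d - 4 * X) ^+ 2 by exact: sqr_ge0.
lra.
Qed.

(** Taking [e = t * a * conjc l] aligns [e * l] with [a], so the modulus grows by [t * nsq l], which
    a bound of order [t ^+ 2] excludes unless [l = 0]. *)
Lemma eq0_of_quadratic_bound (a l : R[i]) (D : R) : normc a = 1 ->
  (forall e, normc (a + e * l) <= 1 + D * normc e ^+ 2) -> l = 0.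
Proof.
move=> a1 h; apply/eqP; rewrite -normc_eq0 -[_ == 0]orbb -mulf_eq0 -expr2 normc_sq.
rewrite eq_le nsq_ge0 andbT.
apply: (@le0_of_small _ _ (D * nsq l)) => t /andP[t0 _].
have := h (t%:C * a * conjc l).
have -> : a + t%:C * a * conjc l * l = a * (1 + t * nsq l)%:C.
  have -> : (1 + t * nsq l)%:C = 1 + t%:C * (nsq l)%:C by rewrite rmorphD rmorphM.
  by rewrite -mulrA mul_conjc; ring.
rewrite !ComplexField.Normc.normcM a1 mul1r mulr1 !normc_real normc_conj.
rewrite !ger0_norm ?addr_ge0 ?mulr_ge0 ?nsq_ge0 ?(ltW t0) //.
rewrite exprMn normc_sq lerD2l => k.
by rewrite -(ler_pM2l t0); lra.
Qed.

End Peak.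

(** * Isometries for two radii *)

Section SupNorm.
Variable R : realType.
Local Notation C := (R[i])^o.
Implicit Types (f g : C -> C) (r M : R).

Lemma holo_cdiff f z : holo f -> normc z < 1 -> cdiff f z.
Proof. by move=> hf z1; apply: derivable_cdiff; exact: hf. Qed.

Lemma holo_cst (c : C) : holo (fun=> c).
Proof. by move=> z _; exact: derivable_cst. Qed.

Lemma holo_id : holo (fun z : C => z).
Proof. by move=> z _; exact: derivable_id. Qed.

Lemma holo_lin (a b : C) f g : holo f -> holo g -> holo (fun w => a * f w + b * g w).
Proof.
move=> hf hg z z1; have -> : (fun w => a * f w + b * g w) = (a \*: f) + (b \*: g).
  by apply/funext => w.
by apply: derivableD; apply: derivableZ; [exact: hf | exact: hg].
Qed.

Lemma supnorm_max f r : holo f -> 0 < r < 1 ->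
  exists2 z0, normc z0 <= r & supnorm r f = normc (f z0) /\
    forall z, normc z <= r -> normc (f z) <= supnorm r f.
Proof.
move=> hf /andP[r0 r1].
have [z zr|z0 z0r z0P] := @disc_max R f r r0.
  by apply: cdiff_ccont; apply: holo_cdiff => //; lra.
have E : supnorm r f = normc (f z0).
  apply/eqP; rewrite eq_le; apply/andP; split.
    by apply: sup_le_ub; [exists (normc (f z0)), z0 | move=> _ [z zr <-]; exact: z0P].
  apply: sup_upper_bound; last by exists z0.
  split; first by exists (normc (f z0)), z0.
  by exists (normc (f z0)) => _ [z zr <-]; exact: z0P.
by exists z0 => //; split=> // z zr; rewrite E z0P.
Qed.

Lemma le_supnorm f r z : holo f -> 0 < r < 1 -> normc z <= r ->
  normc (f z) <= supnorm r f.
Proof. by move=> hf rr zr; have [z0 _ [_]] := supnorm_max hf rr; exact. Qed.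

Lemma supnorm_le f r M : holo f -> 0 < r < 1 ->
  (forall z, normc z <= r -> normc (f z) <= M) -> supnorm r f <= M.
Proof. by move=> hf rr fM; have [z0 z0r [-> _]] := supnorm_max hf rr; exact: fM. Qed.

(** Parallelogram law: the hypotheses leave no room for [nsq (a - p)]. *)
Lemma eq_of_normcD (a p : R[i]) r : normc a <= r -> normc p = r ->
  2 * r <= normc (a + p) -> a = p.
Proof.
move=> ar pr ap; have r0 : 0 <= r by rewrite -pr normc_ge0.
have := nsq_le ar; have : nsq p = r ^+ 2 by rewrite -normc_sq pr.
have : (2 * r) ^+ 2 <= nsq (a + p).
  by rewrite -normc_sq ler_sqr ?nnegrE ?normc_ge0 // mulr_ge0.
move=> h1 h2 h3; apply/eqP; rewrite -subr_eq0 -normc_eq0.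
rewrite -[_ == 0]orbb -mulf_eq0 -expr2 normc_sq eq_le nsq_ge0 andbT.
have -> : nsq (a - p) = 2 * nsq a + 2 * nsq p - nsq (a + p).
  by case: (a) (p) => [x y] [x' y']; rewrite /nsq /=; ring.
by move: h1; rewrite exprMn; lra.
Qed.

End SupNorm.

(** * Two-radius isometries are weighted rotations *)

Theorem theorem2p1 (R : realType) (r1 r2 : R)
  (T : ((R[i])^o -> (R[i])^o) -> ((R[i])^o -> (R[i])^o)) :
  0 < r1 -> r1 < r2 -> r2 < 1 ->
  (* T maps Hol(D) into Hol(D) *)
  (forall f, holo f -> holo (T f)) ->
  (* T respects equality on D (T is well defined on Hol(D)) *)
  (forall f g, holo f -> holo g -> (forall z, udisc z -> f z = g z) ->
     forall z, udisc z -> T f z = T g z) ->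
  (* T is linear *)
  (forall (a b : (R[i])^o) f g, holo f -> holo g ->
     forall z, udisc z -> T (fun w => a * f w + b * g w) z = a * T f z + b * T g z) ->
  (* T is continuous for the topology of uniform convergence on compacts of D *)
  (forall f, holo f -> forall (K : set (R[i])^o) (eps : R), compact K -> K `<=` udisc -> 0 < eps ->
     exists (K' : set (R[i])^o) (delta : R), [/\ compact K', K' `<=` udisc, 0 < delta &
       forall g, holo g -> (forall z, K' z -> normc (g z - f z) < delta) ->
         forall z, K z -> normc (T g z - T f z) < eps]) ->
  (* isometry for the two sup-norms *)
  (forall f, holo f -> supnorm r1 (T f) = supnorm r1 f /\ supnorm r2 (T f) = supnorm r2 f) ->
  exists alpha beta : (R[i])^o, [/\ normc alpha = 1, normc beta = 1 &
    forall f, holo f -> forall z, udisc z -> T f z = alpha * f (beta * z)].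
Proof.
move=> r10 r12 r21 Thol _ Tlin _ Tiso.
have rr1 : 0 < r1 < 1 by lra.
have rr2 : 0 < r2 < 1 by lra.
have r20 : 0 < r2 by lra.
pose one : (R[i])^o -> (R[i])^o := fun=> 1.
pose idf : (R[i])^o -> (R[i])^o := fun z => z.
have hone : holo one := @holo_cst R 1.
have hid : holo idf := @holo_id R.
have T_le r f M z : (r = r1 \/ r = r2) -> holo f ->
    (forall w, normc w <= r -> normc (f w) <= M) ->
    normc z <= r -> normc (T f z) <= M.
  move=> rE hf fM zr; have [e1 e2] := Tiso f hf.
  have rr : 0 < r < 1 by case: rE => ->.
  apply: (le_trans (le_supnorm (Thol _ hf) rr zr)).
  have -> : supnorm r (T f) = supnorm r f by case: rE => ->.
  exact: supnorm_le.
have [w0 w0r [w0E _]] := supnorm_max (Thol _ hone) rr1.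
pose alpha := T one w0.
have nalpha : normc alpha = 1.
  rewrite -w0E (Tiso _ hone).1; apply/eqP; rewrite eq_le; apply/andP; split.
    by apply: supnorm_le => // z _; rewrite ComplexField.Normc.normc1.
  have := @le_supnorm R one r1 0 hone rr1; rewrite ComplexField.Normc.normc1; apply.
  by rewrite ComplexField.Normc.normc0 ltW.
have alpha0 : alpha != 0 by rewrite -normc_gt0 nalpha.
have Tone z : normc z < r2 -> T one z = alpha.
  move=> zr.
  (* The point [w0], found in the smaller disc, is interior to the larger one, so rigidity on radius
     [r2] applies. *)
  suff : T one z / alpha = 1.
    by move=> /(congr1 (fun x => x * alpha)); rewrite divfK // mul1r.
  apply: (@max_mod_rigid R [::] (fun w => T one w / alpha) r2 w0) => //.
  - move=> w wr _; apply: cdiffM; last exact: cdiff_cst.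
    by apply: (holo_cdiff (Thol _ hone)); lra.
  - move=> w wr; rewrite normc_div nalpha divr1; apply: (T_le r2) => //; first by right.
    by move=> v _; rewrite ComplexField.Normc.normc1.
  - by lra.
  - exact: divff.
pose phi z := T idf z / alpha.
have phi_at p : normc p = r1 -> exists2 q, normc q <= r1 & phi q = p.
  move=> pr; pose f := (fun w => 1 * idf w + p * one w).
  have hf : holo f by exact: holo_lin.
  have [q qr [qE _]] := supnorm_max (Thol _ hf) rr1.
  exists q => //; apply: (@eq_of_normcD R (phi q) p r1) => //.
    by rewrite normc_div nalpha divr1; apply: (T_le r1) => //; left.
  have -> : normc (phi q + p) = normc (T f q).
    rewrite (Tlin 1 p _ _ hid hone) /udisc /mkset; last by lra.
    rewrite (Tone q); last by lra.
    have -> : 1 * T idf q + p * alpha = (phi q + p) * alpha.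
      by rewrite mul1r mulrDl divfK.
    by rewrite ComplexField.Normc.normcM nalpha mulr1.
  (* The function [f] takes the value [2 * p] at [p], so its norm is at least [2 * r1]. *)
  rewrite -qE (Tiso _ hf).1.
  have pr' : normc p <= r1 by rewrite pr.
  have := le_supnorm hf rr1 pr'; rewrite /f /idf /one.
  have -> : 1 * p + p * 1 = 2%:R%:C * p by rewrite rmorph_nat; ring.
  by rewrite ComplexField.Normc.normcM normc_real ger0_norm // pr.
have nr1 : normc r1%:C = r1 by rewrite normc_real gtr0_norm.
have [q qr phiq] := phi_at _ nr1.
have [|q' q'r phiq'] := phi_at (- r1%:C); first by rewrite normc_opp.
have [|z zr|beta nbeta phiE] :=
  @rotation_of_antipodal R phi r2 r1 q q' r10 r12 _ _ qr q'r phiq phiq'.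
- move=> z zr; apply: cdiffM; last exact: cdiff_cst.
  by apply: (holo_cdiff (Thol _ hid)); lra.
- by rewrite normc_div nalpha divr1; apply: (T_le r2) => //; right.
have Tid z : normc z < r2 -> T idf z = alpha * (beta * z).
  by move=> zr; rewrite -phiE // /phi mulrC divfK.
have nbz z : normc (beta * z) = normc z.
  by rewrite ComplexField.Normc.normcM nbeta mul1r.
exists alpha, beta; split => // f hf.
have on_circle z : normc z = r1 -> T f z - alpha * f (beta * z) = 0.
  move=> zr; pose p := beta * z.
  have pr : normc p = r1 by rewrite nbz.
  have p1 : normc p < 1 by lra.
  have [|K fK] := @cdiff_bounded R f r1 r10.
    by move=> w wr; apply: holo_cdiff => //; lra.
  have [|D D0 fD] := cdiff_lipschitz_at (holo_cdiff hf p1) fK; first by rewrite pr.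
  apply: (@eq0_of_quadratic_bound R alpha _ (2 * (D * r1) ^+ 2)) => // e.
  pose k := conjc p / (2 * (r1 ^+ 2)%:C).
  (* [h] peaks at [p] with value 1 and [T h z = alpha], while [g] vanishes at [p]; hence [T] sends
     [h + e * g] to [alpha + e * (T f z - alpha * f p)] at [z]. *)
  pose h := (fun w => 2^-1 * one w + k * idf w).
  pose g := (fun w => 1 * f w + (- f p) * one w).
  have hh : holo h by exact: holo_lin.
  have hg : holo g by exact: holo_lin.
  have z1 : udisc z by rewrite /udisc /mkset; lra.
  have zr2 : normc z < r2 by lra.
  have r2C : (r1 ^+ 2)%:C != 0 :> R[i].
    by rewrite -normc_gt0 normc_real normr_gt0 expf_neq0 ?gt_eqF.
  have kp : k * p = 2^-1.
    rewrite /k mulrAC.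
    have -> : conjc p * p = (r1 ^+ 2)%:C by rewrite mul_conjc -normc_sq pr.
    by move: ((r1 ^+ 2)%:C) r2C => x x0; field; rewrite x0.
  have -> : alpha + e * (T f z - alpha * f (beta * z)) =
      T (fun w => 1 * h w + e * g w) z.
    rewrite (Tlin 1 e h g hh hg z z1) (Tlin _ _ _ _ hone hid z z1).
    rewrite (Tlin _ _ _ _ hf hone z z1) Tone // Tid // -/p.
    have -> : k * (alpha * p) = 2^-1 * alpha by rewrite mulrCA kp mulrC.
    by field.
  have hhg : holo (fun w => 1 * h w + e * g w) by exact: holo_lin.
  have zr' : normc z <= r1 by rewrite zr.
  refine (T_le r1 _ _ z (or_introl erefl) hhg _ zr') => w wr.
  have := peak_bound e r10 pr wr (fD w wr).
  by rewrite /h /g /one /idf !mul1r !mulr1.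
have cd z : normc z < 1 -> cdiff (fun w => T f w - alpha * f (beta * w)) z.
  move=> z1; apply: cdiffB; first exact: (holo_cdiff (Thol _ hf)).
  apply: cdiffM; first exact: cdiff_cst.
  apply: (@cdiff_comp R (fun w => beta * w) f).
    by apply: cdiffM; [exact: cdiff_cst | exact: cdiff_id].
  by apply: holo_cdiff => //; rewrite nbz.
move=> z z1; apply/eqP; rewrite -subr_eq0; apply/eqP.
apply: (@unique_continuation R (fun w => T f w - alpha * f (beta * w)) r1) => //.
  by lra.
(* The maximum principle with bound 0 extends the vanishing from the circle to its disc. *)
move=> w wr; apply/eqP; rewrite -normc_eq0 eq_le normc_ge0 andbT.
apply: (@max_mod R (fun w => T f w - alpha * f (beta * w)) r1) => // v vr.
  by apply: cd; lra.
by rewrite on_circle // ComplexField.Normc.normc0.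
Qed.
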